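(* Let $Y$, $x$, $T$ be as in the context, with $Y$ not isomorphic to $O_{D+1}$ or $\Box_{2D+1}$, and let $q,s,h,h^*\in\mathbb{C}$ with $q,h,h^*$ nonzero satisfy $\theta_i=\theta_0+h(1-q^i)(1-sq^{i+1})q^{-i}$ and $\theta^*_i=\theta^*_0+h^*(1-q^i)(1-q^{-2D-1+i})q^{-i}$ for $0\le i\le D$. Let $W$ be an irreducible $T$-module with dual endpoint $t$ and diameter $d$. If $d=0$ then $c_0(W)=0$, $a_0(W)=hq^{-t}(1+sq^{2t+1})$, $b_0(W)=0$. If $d\ge1$ then $c_0(W)=0$; $c_i(W)=\dfrac{h(1-q^i)(1+sq^{2+2d+2t-i})}{q^{t+i}(q^{2d-2i+1}-1)}$ for $1\le i\le d-1$; $c_d(W)=\dfrac{h(1-q^d)(1+sq^{2+d+2t})}{q^{t+d}(q-1)}$; $a_i(W)=0$ for $0\le i\le d-1$; $a_d(W)=\dfrac{h(q^{d+1}-1)(1+sq^{1+d+2t})}{q^{t+d}(q-1)}$; $b_0(W)=hq^{-t}(sq^{2t+1}+1)$; $b_i(W)=\dfrac{h(q^{2d+1-i}-1)(1+sq^{2t+i+1})}{q^{t+i}(q^{2d-2i+1}-1)}$ for $1\le i\le d-1$; $b_d(W)=0$.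
   Context: $Y=(X,\{R_i\}_{0\le i\le D})$ is a symmetric association scheme ($X$ finite; $R_i$ partition $X\times X$, $R_0$ diagonal, $R_i$ symmetric; $p^h_{ij}=|\{z:(x,z)\in R_i,(z,y)\in R_j\}|$ for $(x,y)\in R_h$ independent of $x,y$), with $D\ge3$, associate matrices $A_i$, Bose–Mesner algebra $M=\mathrm{span}\{A_i\}$ with primitive idempotents $E_0,\dots,E_D$, Krein parameters $q^h_{ij}$ ($E_i\circ E_j=|X|^{-1}\sum_hq^h_{ij}E_h$). $Y$ is P-polynomial w.r.t. $R_0,\dots,R_D$ ($p^h_{ij}=0$ if one of $h,i,j$ exceeds the sum of the other two, $\ne0$ if it equals that sum), almost-bipartite ($p^i_{1i}=0$ for $0\le i\le D-1$, $p^D_{1D}\ne0$), and Q-polynomial w.r.t. $E_0,\dots,E_D$ (same conditions for $q^h_{ij}$). $A=A_1$, $AE_i=\theta_iE_i$. Fix $x\in X$: $E^*_i$ diagonal with $(E^*_i)_{yy}=1$ iff $(x,y)\in R_i$; $A^*$ diagonal with $(A^* )_{yy}=|X|(E_1)_{xy}$; $A^*E^*_i=\theta^*_iE^*_i$; $E^*_i=0$ for $i\notin[0,D]$. $T=T(x)$ is generated by $M$ and $\mathrm{span}\{E^*_i\}$. $R=\sum_iE^*_{i+1}AE^*_i$, $F=\sum_iE^*_iAE^*_i$, $L=\sum_iE^*_{i-1}AE^*_i$. For an irreducible $T$-module $W$: endpoint $r=\min\{i:E^*_iW\neq0\}$, dual endpoint $t=\min\{i:E_iW\ne0\}$, diameter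 $d=|\{i:E^*_iW\ne0\}|-1$. In this setting $W$ is thin and dual thin; $c_i(W),a_i(W),b_i(W)$ ($0\le i\le d$) are defined by $RE^*_{r+i-1}v=c_i(W)E^*_{r+i}v$, $FE^*_{r+i}v=a_i(W)E^*_{r+i}v$, $LE^*_{r+i+1}v=b_i(W)E^*_{r+i}v$ for nonzero $v\in E_tW$. $O_{D+1}$ is the distance scheme of the Odd graph (vertices the $D$-subsets of a $(2D+1)$-set, adjacent when disjoint); $\Box_{2D+1}$ the distance scheme of the folded $(2D+1)$-cube. (Such $q,s,h,h^*$ exist for $Y$.) *)

(* Defs.v *)
(* Matrices are indexed by 'I_#|X|, identified with the finite vertex set X
   through enum_val / enum_rank; C plays the role of the complex field. *)
From mathcomp Require Import all_boot all_order all_algebra.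
Set Implicit Arguments.
Unset Strict Implicit.
Unset Printing Implicit Defensive.
Import Order.TTheory GRing.Theory Num.Theory.
Local Open Scope ring_scope.

(* The ordered partition R_0, ..., R_D of X * X is encoded by the class index:
   cls Y x y = i  iff  (x, y) \in R_i.  The field pnum is only meaningful for
   indices at most D. *)
Record symScheme (X : finType) (D : nat) : Type := SymScheme {
  cls : X -> X -> nat;
  pnum : nat -> nat -> nat -> nat;
  cls_le : forall x y, (cls x y <= D)%N;
  cls_nonempty : forall i, (i <= D)%N -> exists x y, cls x y = i;
  cls_diag : forall x y, cls x y = 0%N <-> x = y;
  cls_sym : forall x y, cls x y = cls y x;
  pnumE : forall h i j, (h <= D)%N -> (i <= D)%N -> (j <= D)%N ->
    forall x y, cls x y = h ->
    #|[set z | (cls x z == i) && (cls z y == j)]| = pnum h i j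
}.

(* The condition shared by the P-polynomial (f h i j = p^h_ij) and
   Q-polynomial (f h i j = q^h_ij) properties. *)
Definition poly_ordering (V : nmodType) (D : nat) (f : nat -> nat -> nat -> V) :
    Prop :=
  forall h i j, (h <= D)%N -> (i <= D)%N -> (j <= D)%N ->
    ([|| (i + j < h)%N, (h + j < i)%N | (h + i < j)%N] -> f h i j = 0) /\
    ([|| h == (i + j)%N, i == (h + j)%N | j == (h + i)%N] -> f h i j <> 0).

Definition P_polynomial X D (Y : symScheme X D) : Prop :=
  poly_ordering D (pnum Y).

Definition almost_bipartite X D (Y : symScheme X D) : Prop :=
  (forall i, (i < D)%N -> pnum Y i 1 i = 0%N) /\ pnum Y D 1 D <> 0%N.

(* Distance schemes of graphs, and isomorphism of Y with such a scheme. *)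

Definition is_dist (V : eqType) (e : rel V) (u v : V) (n : nat) : Prop :=
  (exists p, [/\ path e u p, last u p = v & size p = n]) /\
  (forall p, path e u p -> last u p = v -> (n <= size p)%N).

Definition iso_distance_scheme X D (Y : symScheme X D) (V : finType)
    (e : rel V) : Prop :=
  exists f : X -> V,
    bijective f /\ forall x y, is_dist e (f x) (f y) (cls Y x y).

Definition odd_vertex (D : nat) := {S : {set 'I_(2 * D + 1)} | #|S| == D}.

Definition odd_graph (D : nat) : rel (odd_vertex D) :=
  fun S U => [disjoint val S & val U].

(* The vertices of the folded n-cube are the antipodal pairs {S, ~S} of
   vertices of the n-cube, the latter being the subsets of 'I_n. *)
Definition folded_vertex (n : nat) :=
  {P : {set {set 'I_n}} | [exists S, P == [set S; ~: S]]}.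

Definition folded_cube (n : nat) : rel (folded_vertex n) :=
  fun P Q => [exists S in val P, [exists U in val Q,
    #|(S :\: U) :|: (U :\: S)| == 1%N]].

Section Algebras.

Variables (C : numClosedFieldType) (X : finType) (D : nat) (Y : symScheme X D).

Local Notation Mat := 'M[C]_#|X|.
Local Notation Vec := 'cV[C]_#|X|.

Definition assoc_mx (i : nat) : Mat :=
  \matrix_(y, z) (cls Y (enum_val y) (enum_val z) == i)%:R.

Definition bose_mesner (B : Mat) : Prop :=
  exists c : nat -> C, B = \sum_(i < D.+1) c i *: assoc_mx i.

(* As dim M = D + 1, such a family is the complete list of the primitive
   idempotents of M. *)
Record primitive_idempotents (E : nat -> Mat) : Prop := PrimitiveIdempotents {
  idem_bose_mesner : forall i, (i <= D)%N -> bose_mesner (E i);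
  idem_neq0 : forall i, (i <= D)%N -> E i <> 0;
  idem_mul : forall i j, (i <= D)%N -> (j <= D)%N ->
    E i *m E j = if i == j then E i else 0;
  idem_sum : \sum_(i < D.+1) E i = 1%:M;
  idem_triv : E 0%N = const_mx (#|X|%:R^-1)
}.

Definition krein_parameters (E : nat -> Mat) (qnum : nat -> nat -> nat -> C) :
    Prop :=
  forall i j, (i <= D)%N -> (j <= D)%N ->
    map2_mx *%R (E i) (E j) = #|X|%:R^-1 *: \sum_(h < D.+1) qnum h i j *: E h.

(* The Krein parameters with indices at most D are determined by E. *)
Definition Q_polynomial (E : nat -> Mat) : Prop :=
  exists qnum, krein_parameters E qnum /\ poly_ordering D qnum.

Variable x : X.

(* Indexed by int so that E*_(-1) = E*_(D+1) = 0. *)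
Definition dual_idem (i : int) : Mat :=
  diag_mx (\row_y ((cls Y x (enum_val y))%:Z == i)%:R).

Definition dual_adj (E : nat -> Mat) : Mat :=
  diag_mx (\row_y (#|X|%:R * E 1%N (enum_rank x) y)).

Inductive terwilliger : Mat -> Prop :=
| Terw_M B of bose_mesner B : terwilliger B
| Terw_dual (i : nat) of (i <= D)%N : terwilliger (dual_idem i%:Z)
| Terw_scale (a : C) B of terwilliger B : terwilliger (a *: B)
| Terw_add B1 B2 of terwilliger B1 & terwilliger B2 : terwilliger (B1 + B2)
| Terw_mul B1 B2 of terwilliger B1 & terwilliger B2 : terwilliger (B1 *m B2).

Definition raising : Mat :=
  \sum_(i < D.+1) dual_idem (i%:Z + 1) *m assoc_mx 1 *m dual_idem i%:Z.
Definition flat : Mat :=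
  \sum_(i < D.+1) dual_idem i%:Z *m assoc_mx 1 *m dual_idem i%:Z.
Definition lowering : Mat :=
  \sum_(i < D.+1) dual_idem (i%:Z - 1) *m assoc_mx 1 *m dual_idem i%:Z.

(* T acts on column vectors by left multiplication. *)
Definition T_module (W : {vspace Vec}) : Prop :=
  forall B, terwilliger B -> forall v, v \in W -> B *m v \in W.

Definition irreducible_T_module (W : {vspace Vec}) : Prop :=
  [/\ T_module W, W <> 0%VS &
      forall U : {vspace Vec}, T_module U -> (U <= W)%VS ->
        U = 0%VS \/ U = W].

Definition mx_image (B : Mat) (W : {vspace Vec}) : {vspace Vec} :=
  (linfun (mulmx B : Vec -> Vec) @: W)%VS.

(* find returns the least index in 0, ..., D with the given property. *)
Definition endpoint (W : {vspace Vec}) : nat :=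
  find (fun i : nat => mx_image (dual_idem i%:Z) W != 0%VS) (iota 0 D.+1).

Definition dual_endpoint (E : nat -> Mat) (W : {vspace Vec}) : nat :=
  find (fun i : nat => mx_image (E i) W != 0%VS) (iota 0 D.+1).

Definition diameter (W : {vspace Vec}) : nat :=
  #|[set i : 'I_D.+1 | mx_image (dual_idem i%:Z) W != 0%VS]|.-1.

(* is_cW E W i c means "c_i(W) = c": the scalar c, and no other one, satisfies
   the equation defining c_i(W).  Similarly for a_i(W) and b_i(W). *)

Definition is_cW (E : nat -> Mat) (W : {vspace Vec}) (i : nat) : C -> Prop :=
  let r := (endpoint W)%:Z in let t := dual_endpoint E W in
  unique (fun c => forall v, v \in mx_image (E t) W -> v <> 0 ->
    raising *m (dual_idem (r + i%:Z - 1) *m v)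
      = c *: (dual_idem (r + i%:Z) *m v)).

Definition is_aW (E : nat -> Mat) (W : {vspace Vec}) (i : nat) : C -> Prop :=
  let r := (endpoint W)%:Z in let t := dual_endpoint E W in
  unique (fun a => forall v, v \in mx_image (E t) W -> v <> 0 ->
    flat *m (dual_idem (r + i%:Z) *m v) = a *: (dual_idem (r + i%:Z) *m v)).

Definition is_bW (E : nat -> Mat) (W : {vspace Vec}) (i : nat) : C -> Prop :=
  let r := (endpoint W)%:Z in let t := dual_endpoint E W in
  unique (fun b => forall v, v \in mx_image (E t) W -> v <> 0 ->
    lowering *m (dual_idem (r + i%:Z + 1) *m v)
      = b *: (dual_idem (r + i%:Z) *m v)).

End Algebras.

(* Main.v *)
(* Let v be a nonzero vector of E_t W that is an eigenvector of E_t A^*.  Then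
   A v = theta_t v, and A A^* v is a combination of A^* v and v because A^* v
   lies in E_t W + E_(t+1) W.  Projected to a subconstituent E^*_i V with i < D,
   where F vanishes, these are two linear equations for L E^*_(i+1) v and
   R E^*_(i-1) v, and at i = D for F E^*_D v and R E^*_(D-1) v.  Hence the
   E^*_i v span a submodule, which is W, and the coefficients c_i, a_i, b_i
   solve 2 x 2 systems once the endpoint r is known.  Applied to the all-ones
   vector, the same equations give the intersection numbers of Y, whose
   nonvanishing shows 1 + s q^j != 0 for 1 <= j <= 2D + 1.  If r + d < D, the systems at both ends
   of W would force 1 + s q^(2t+d+1) = 0; so r + d = D.  The normalization
   theta_0 = h (1 + s q) comes from the tridiagonal relation. *)

Require Import Defs.
From mathcomp Require Import all_boot all_order all_algebra.
From mathcomp Require Import ring zify.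
Import GRing.Theory Num.Theory.
Local Open Scope ring_scope.

(** The computation rests on the symmetry of theta^*_i = e + h^* (q^-i + q^(i-2D-1)) under i ->
    2D+1-i. It makes theta^*_D and the extrapolated theta^*_(D+1) equal, so the edges inside layer D
    act like edges to a further layer D + 1: F at layer D takes the place of L in the systems, and
    [coef_end] has the formulas of [coef_interior] at m = 1. Thinness and dual thinness of W are
    derived. E_t W is not known at the start to be a line, so v must be chosen as an eigenvector of
    E_t A^*; that E_t W is a line follows afterwards from a three-term recurrence for A. No
    hypothesis says that the factors 1 - q^j and 1 + s q^j are nonzero in the required range; the
    former comes from the distinctness of the dual eigenvalues. The exponent 2t + d + 1 lies in the
    covered range up to 2D + 1 because t + d <= D, which needs its own argument. The given form of
    theta_i fixes only the differences theta_i - theta_0, while the systems involve theta_t itself;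
    hence the normalization. *)

(* In the next three lemmas u, a, T stand for q^r, q^i (or q^d) and q^t, and z
   stands for q^j in the dual eigenvalue sg z; kap comes from
   A A^* v = theta_(t+1) A^* v + kap v.  Here m = q^(d-i), so u a m = q^D. *)
Lemma coef_interior {C : fieldType} (q u a m T h hs s e th th' kap b c : C)
    (sg := fun z => e + hs * (z^-1 + z / (q * (u * a * m) ^+ 2))) :
  q != 0 -> u != 0 -> a != 0 -> m != 0 -> T != 0 -> hs != 0 ->
  q ^+ 2 != 1 -> q * m ^+ 2 != 1 ->
  th = h * T^-1 * (1 + s * q * T ^+ 2) ->
  th' = h * (q * T)^-1 * (1 + s * q * (q * T) ^+ 2) ->
  sg (q * u) * th = th' * sg u + kap ->
  b + c = th ->
  sg (q * u * a) * b + sg (u * a / q) * c = th' * sg (u * a) + kap ->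
  c = h * (1 - a) * (1 + s * q ^+ 2 * a * m ^+ 2 * T ^+ 2)
        / (T * a * (q * m ^+ 2 - 1)) /\
  b = h * (q * a * m ^+ 2 - 1) * (1 + s * q * T ^+ 2 * a)
        / (T * a * (q * m ^+ 2 - 1)).
Proof.
move=> q0 u0 a0 m0 T0 hs0 q2 qm Eth Eth' Hk Hb Hc.
set x := (X in c = X).
have n1 : q ^+ 2 - 1 != 0 by rewrite subr_eq0.
have n2 : q * m ^+ 2 - 1 != 0 by rewrite subr_eq0.
(* The equation at the endpoint eliminates [kap], and [b = th - c] leaves [c] as the only
   unknown. *)
have lin : (sg (u * a / q) - sg (q * u * a)) * c
     = th' * (sg (u * a) - sg u) - th * (sg (q * u * a) - sg (q * u)).
  apply/eqP; rewrite -subr_eq0; apply/eqP.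
  transitivity ((sg (q * u * a) * b + sg (u * a / q) * c
      - (th' * sg (u * a) + kap))
    - (sg (q * u) * th - (th' * sg u + kap))); first by rewrite -Hb; ring.
  by rewrite Hc Hk !subrr.
have cx : c = x.
  have kE : sg (u * a / q) - sg (q * u * a)
     = hs * (q ^+ 2 - 1) * (q * m ^+ 2 - 1) / (u * a * q ^+ 2 * m ^+ 2).
    by rewrite /sg; field; rewrite q0 u0 a0 m0.
  have k0 : sg (u * a / q) - sg (q * u * a) != 0.
    by rewrite kE !(mulf_neq0, invr_neq0, expf_neq0).
  apply: (mulfI k0); rewrite lin kE /x Eth Eth' /sg; field.
  by rewrite q0 u0 a0 m0 T0 n2.
split=> //.
have -> : b = th - c by rewrite -Hb addrK.
rewrite cx /x Eth; field.
by rewrite T0 a0 n2.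
Qed.

Lemma coef_end {C : fieldType} (q u a T h hs s e th th' kap c f : C)
    (sg := fun z => e + hs * (z^-1 + z / (q * (u * a) ^+ 2))) :
  q != 0 -> u != 0 -> a != 0 -> T != 0 -> hs != 0 -> q ^+ 2 != 1 -> q != 1 ->
  th = h * T^-1 * (1 + s * q * T ^+ 2) ->
  th' = h * (q * T)^-1 * (1 + s * q * (q * T) ^+ 2) ->
  sg (q * u) * th = th' * sg u + kap ->
  f + c = th ->
  sg (u * a) * f + sg (u * a / q) * c = th' * sg (u * a) + kap ->
  c = h * (1 - a) * (1 + s * q ^+ 2 * a * T ^+ 2) / (T * a * (q - 1)) /\
  f = h * (q * a - 1) * (1 + s * q * T ^+ 2 * a) / (T * a * (q - 1)).
Proof.
move=> q0 u0 a0 T0 hs0 q2 q1 Eth Eth' Hk Hb Hc.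
set x := (X in c = X).
have n1 : q - 1 != 0 by rewrite subr_eq0.
have n2 : q ^+ 2 - 1 != 0 by rewrite subr_eq0.
have lin : (sg (u * a / q) - sg (u * a)) * c
     = th' * (sg (u * a) - sg u) - th * (sg (u * a) - sg (q * u)).
  apply/eqP; rewrite -subr_eq0; apply/eqP.
  transitivity ((sg (u * a) * f + sg (u * a / q) * c - (th' * sg (u * a) + kap))
    - (sg (q * u) * th - (th' * sg u + kap))); first by rewrite -Hb; ring.
  by rewrite Hc Hk !subrr.
have cx : c = x.
  have kE : sg (u * a / q) - sg (u * a) = hs * (q - 1) * (q ^+ 2 - 1) / (u * a *
    q ^+ 2).
    by rewrite /sg; field; rewrite q0 u0 a0.
  have k0 : sg (u * a / q) - sg (u * a) != 0.
    by rewrite kE !(mulf_neq0, invr_neq0, expf_neq0).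
  apply: (mulfI k0); rewrite lin kE /x Eth Eth' /sg; field.
  by rewrite q0 u0 a0 T0 n1.
split=> //.
have -> : f = th - c by rewrite -Hb addrK.
rewrite cx /x Eth; field.
by rewrite T0 a0 n1.
Qed.

(* Here w = q^D and u a = q^(r+d) with r + d < D. *)
Lemma coef_bipartite {C : fieldType} (q u a w T h hs s e th th' kap : C)
    (sg := fun z => e + hs * (z^-1 + z / (q * w ^+ 2))) :
  q != 0 -> u != 0 -> a != 0 -> w != 0 -> T != 0 -> hs != 0 -> h != 0 ->
  q ^+ 2 != 1 -> u ^+ 2 * a != q * w ^+ 2 ->
  th = h * T^-1 * (1 + s * q * T ^+ 2) ->
  th' = h * (q * T)^-1 * (1 + s * q * (q * T) ^+ 2) ->
  sg (q * u) * th = th' * sg u + kap ->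
  sg (u * a / q) * th = th' * sg (u * a) + kap ->
  1 + s * q * T ^+ 2 * a = 0.
Proof.
move=> q0 u0 a0 w0 T0 hs0 h0 q2 uw Eth Eth' Hk Hc.
have n1 : q ^+ 2 - 1 != 0 by rewrite subr_eq0.
have n2 : q * w ^+ 2 - u ^+ 2 * a != 0 by rewrite subr_eq0 eq_sym.
have lin : th * (sg (u * a / q) - sg (q * u)) - th' * (sg (u * a) - sg u) = 0.
  transitivity ((sg (u * a / q) * th - (th' * sg (u * a) + kap))
    - (sg (q * u) * th - (th' * sg u + kap))); first by ring.
  by rewrite Hc Hk !subrr.
have := lin.
have -> : th * (sg (u * a / q) - sg (q * u)) - th' * (sg (u * a) - sg u)
  = (hs * h * (q ^+ 2 - 1) * (q * w ^+ 2 - u ^+ 2 * a)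
       / (u * a * q ^+ 2 * w ^+ 2 * T)) * (1 + s * q * T ^+ 2 * a).
  by rewrite Eth Eth' /sg; field; rewrite q0 u0 a0 T0 w0.
move/eqP; rewrite mulf_eq0 => /orP[|/eqP //].
by rewrite !(mulf_eq0, invr_eq0, expf_eq0) /= (negbTE n1) (negbTE n2) (negbTE
  q0)
  (negbTE u0) (negbTE a0) (negbTE w0) (negbTE T0) (negbTE h0) (negbTE hs0).
Qed.

(** * Layers of a vector: [layer] abstracts E^*_i, and [layer_scale] abstracts A^* *)

Definition layer {F : fieldType} {n} (k : 'I_n -> nat) (i : nat) : 'M[F]_n :=
  diag_mx (\row_y (k y == i)%:R).
Definition layer_scale {F : fieldType} {n} (k : 'I_n -> nat) (sg : nat -> F) :
  'M[F]_n := diag_mx (\row_y sg (k y)).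

Section Layers.

Context {F : fieldType} {n D : nat} {k : 'I_n -> nat}.
Local Notation layer := (@layer F n k).
Local Notation layer_scale := (@layer_scale F n k).

Lemma layerE i (v : 'cV[F]_n) y j : (layer i *m v) y j = (k y == i)%:R * v y j.
Proof. by rewrite mul_diag_mx !mxE. Qed.

Lemma layer_scaleE sg (v : 'cV[F]_n) y j :
  (layer_scale sg *m v) y j = sg (k y) * v y j.
Proof. by rewrite mul_diag_mx !mxE. Qed.

Lemma layer_layer i j (v : 'cV[F]_n) :
  layer i *m (layer j *m v) = (i == j)%:R *: (layer j *m v).
Proof.
apply/matrixP=> y z; rewrite !layerE [RHS]mxE !layerE mulrA.
case: (eqVneq (k y) j) => [->|]; last by rewrite !(mul0r, mulr0).
by rewrite eq_sym mul1r mulr1.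
Qed.

Lemma layer_scale_layer sg i (v : 'cV[F]_n) :
  layer_scale sg *m (layer i *m v) = sg i *: (layer i *m v).
Proof.
apply/matrixP=> y z; rewrite layer_scaleE [RHS]mxE layerE.
by case: eqP => [->|]; rewrite ?mul0r ?mulr0.
Qed.

Lemma layerC sg i (v : 'cV[F]_n) :
  layer i *m (layer_scale sg *m v) = sg i *: (layer i *m v).
Proof.
apply/matrixP=> y z; rewrite layerE layer_scaleE [RHS]mxE layerE.
by case: eqP => [->|]; rewrite ?mul0r ?mulr0 // !mul1r.
Qed.

Hypothesis k_le : forall y, (k y <= D)%N.

Lemma layer_gt i (v : 'cV[F]_n) : (D < i)%N -> layer i *m v = 0.
Proof.
move=> Di; apply/matrixP=> y z; rewrite layerE mxE.
by case: eqP => [ki|]; rewrite ?mul0r //; move: (k_le y); rewrite ki leqNgt Di.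
Qed.

Lemma layer_sum (v : 'cV[F]_n) : \sum_(i < D.+1) layer i *m v = v.
Proof.
apply/matrixP=> y z; rewrite summxE.
have ky : (k y < D.+1)%N by rewrite ltnS.
rewrite (bigD1 (Ordinal ky)) //= layerE eqxx mul1r big1 ?addr0 // => i ne.
rewrite layerE; case: eqP => [e|]; rewrite ?mul0r //.
by case/eqP: ne; apply/val_inj.
Qed.

Lemma layer0_eq0 (v : 'cV[F]_n) :
  (forall i, (i <= D)%N -> layer i *m v = 0) -> v = 0.
Proof. by move=> v0; rewrite -[v]layer_sum big1 // => i _;
  rewrite v0 // -ltnS. Qed.

Variable A : 'M[F]_n.
Hypothesis D_gt0 : (0 < D)%N.
Hypothesis A_adj : forall y z, A y z != 0 ->
  [|| k y == (k z).+1, k z == (k y).+1 | (k y == D) && (k z == D)].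

Lemma layer_mul0 i j (v : 'cV[F]_n) :
  ~~ [|| i == j.+1, j == i.+1 | (i == D) && (j == D)] ->
  layer i *m (A *m (layer j *m v)) = 0.
Proof.
move=> nadj; apply/matrixP=> y z; rewrite layerE !mxE.
case: eqP => [ki|]; rewrite ?mul0r // mul1r big1 // => w _; rewrite layerE.
case: (eqVneq (k w) j) => [kw|]; last by rewrite mul0r mulr0.
case: (eqVneq (A y w) 0) => [->|/A_adj]; first by rewrite mul0r.
by rewrite ki kw (negbTE nadj).
Qed.

(* At i = 0 the last two terms coincide, but both vanish. *)
Lemma layer_mul i (v : 'cV[F]_n) : (i <= D)%N ->
  layer i *m (A *m v) = layer i *m (A *m (layer i.+1 *m v))
    + layer i *m (A *m (layer i *m v)) + layer i *m (A *m (layer i.-1 *m v)).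
Proof.
move=> iD; apply/matrixP=> y z; rewrite !(layerE, mxE).
case: eqP => [ki|]; last by rewrite !mul0r !addr0.
rewrite !mul1r -!big_split; apply: eq_bigr => w _ /=; rewrite !layerE.
case: (eqVneq (A y w) 0) => [->|/A_adj]; first by rewrite !mul0r !addr0.
rewrite ki -!mulrDr -!mulrDl => adj; congr (_ * _).
rewrite -[LHS]mul1r; congr (_ * _).
have [/eqP ew|] := boolP (i == (k w).+1).
  have [-> -> ->] : [/\ (k w == i.+1) = false, (k w == i) = false & k w == i.-1]
    by split; lia.
  by rewrite !add0r.
have [/eqP ew|] := boolP (k w == i.+1).
  have [-> ->] : (k w == i) = false /\ (k w == i.-1) = false by split; lia.
  by rewrite !addr0.
move=> n1 n2; move: adj; rewrite (negbTE n1) (negbTE n2) /= => /andP[/eqP iE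
  /eqP ->].
have -> : (D == i.-1) = false by lia.
by rewrite iE eqxx add0r addr0.
Qed.

(* The tridiagonal relation with zero linear part. *)
Lemma layer_scale_tridiag (sg : nat -> F) (be tau : F) (v : 'cV[F]_n) :
  let S := layer_scale sg in
  (forall i, (i < D)%N -> sg i ^+ 2 - be * (sg i * sg i.+1) + sg i.+1 ^+ 2
    = tau) ->
  sg D ^+ 2 - be * (sg D * sg D) + sg D ^+ 2 = tau ->
  S *m (S *m (A *m v)) - be *: (S *m (A *m (S *m v))) + A *m (S *m (S *m v))
    = tau *: (A *m v).
Proof.
move=> S recI recD; have SE w a b : (S *m w) a b = sg (k a) * w a b :=
  layer_scaleE _ _ _ _.
apply/matrixP=> y z; rewrite [LHS]mxE [X in X + _ = _]mxE [X in _ + X + _ =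
  _]mxE.
rewrite [X in _ - X + _]mxE [RHS]mxE !SE !mxE !mulr_sumr -sumrB -big_split.
apply: eq_bigr => w _ /=; rewrite !SE.
have [->|/A_adj adj] := eqVneq (A y w) 0; first by rewrite !(mul0r, mulr0) subrr
  addr0.
suff <- : sg (k y) ^+ 2 - be * (sg (k y) * sg (k w)) + sg (k w) ^+ 2 = tau by
  ring.
have [ky kw] : (k y <= D)%N /\ (k w <= D)%N by [].
case/or3P: adj => [/eqP e|/eqP e|/andP[/eqP -> /eqP -> //]].
- by rewrite -(recI (k w)) -e //; ring.
- by rewrite -(recI (k y)) -e.
Qed.

Section Thin.

Variables (v : 'cV[F]_n) (th th' kap : F) (sg : nat -> F).
Hypothesis sg_inj : forall i j, (i <= D)%N -> (j <= D)%N ->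
  sg i = sg j -> i = j.
Hypothesis Av : A *m v = th *: v.
Hypothesis ASv : A *m (layer_scale sg *m v)
  = th' *: (layer_scale sg *m v) + kap *: v.

Local Notation u i := (layer i *m v).
Local Notation bvec i := (layer i *m (A *m u i.+1)).
Local Notation avec i := (layer i *m (A *m u i)).
Local Notation cvec i := (layer i *m (A *m u i.-1)).

Lemma thin_sum1 i : (i <= D)%N -> bvec i + avec i + cvec i = th *: u i.
Proof. by move=> iD; rewrite -layer_mul // Av -scalemxAr. Qed.

Lemma thin_sum2 i : (i <= D)%N ->
  sg i.+1 *: bvec i + sg i *: avec i + sg i.-1 *: cvec i
    = (th' * sg i + kap) *: u i.
Proof.
move=> iD; have := congr1 (mulmx (layer i)) ASv.
rewrite layer_mul // !layerC mulmxDr -!scalemxAr layerC.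
by rewrite scalerA -scalerDl.
Qed.

Lemma avec0 i : (i < D)%N -> avec i = 0.
Proof. by move=> iD; apply: layer_mul0; lia. Qed.

(** Since [0.-1] is 0, this is the flat term of layer 0, which vanishes because 0 < D. *)
Lemma cvec0 : cvec 0 = 0.
Proof. exact: avec0. Qed.

Lemma bvecD : bvec D = 0.
Proof. by rewrite [u D.+1]layer_gt ?mulmx0. Qed.

(* A v = th v and A S v = th' S v + kap v, projected to layer i, are two linear
   equations for the at most two nonzero vectors among bvec, avec and cvec. *)
Lemma thin_exists i : (i <= D)%N -> exists b a c,
  [/\ bvec i = b *: u i, avec i = a *: u i & cvec i = c *: u i].
Proof.
have solve (p p' m : F) (y z w : 'cV[F]_n) : p != p' ->
    y + z = th *: w -> p *: y + p' *: z = m *: w ->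
    exists b c, y = b *: w /\ z = c *: w.
  move=> ne e1 e2; have n0 : p - p' != 0 by rewrite subr_eq0.
  have yE : y = ((m - p' * th) / (p - p')) *: w.
    have d : (p - p') *: y = (m - p' * th) *: w.
      rewrite scalerBl [RHS]scalerBl -scalerA -e1 -e2.
      by rewrite scalerDr opprD addrACA subrr addr0.
    by rewrite mulrC -scalerA -d scalerA mulVf ?scale1r.
  exists ((m - p' * th) / (p - p')); exists (th - (m - p' * th) / (p - p')).
  by split=> //; rewrite scalerBl -yE -e1 addrAC subrr add0r.
move=> iD; have := thin_sum1 i iD; have := thin_sum2 i iD.
have [iD'|] := ltnP i D.
  rewrite avec0 // scaler0 !addr0 => e2 e1.
  case: i iD iD' e1 e2 => [|i] iD iD'.
    rewrite cvec0 addr0 => -> _; exists th, 0, 0.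
    by rewrite !scale0r.
  move=> e1 e2; have ne : sg i.+2 != sg i.
    by apply: contraTneq isT => /sg_inj E; have := E iD' (ltnW (ltnW iD')); lia.
  case: (solve _ _ _ _ _ _ ne e1 e2) => b [c [-> ->]].
  by exists b, 0, c; rewrite scale0r.
move=> Di; have {iD Di} -> : i = D by apply/eqP; rewrite eqn_leq iD.
rewrite bvecD scaler0 !add0r => e2 e1.
have ne : sg D != sg D.-1.
  by apply: contraTneq isT => /sg_inj E; have := E (leqnn _) (leq_pred _); lia.
case: (solve _ _ _ _ _ _ ne e1 e2) => a [c [-> ->]].
by exists 0, a, c; rewrite scale0r.
Qed.

(** This makes the span of the layers of v stable under A, hence a T-module. *)
Lemma thin_line i j : (j <= D)%N -> (layer j *m (A *m u i) \in <[u j]>)%VS.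
Proof.
move=> jD; have [adj|/layer_mul0 ->] := boolP
  [|| j == i.+1, i == j.+1 | (j == D) && (i == D)];
  last by rewrite mem0v.
have [b [a [c [hb ha hc]]]] := thin_exists j jD.
case/or3P: adj => [/eqP ji|/eqP ->|/andP[/eqP ji /eqP ->]].
- by move: hc; rewrite ji /= => ->; rewrite memvZ ?memv_line.
- by rewrite hb memvZ ?memv_line.
- by move: ha; rewrite ji => ->; rewrite memvZ ?memv_line.
Qed.

Lemma thin_eqs i b a c : (i <= D)%N -> u i != 0 ->
  bvec i = b *: u i -> avec i = a *: u i -> cvec i = c *: u i ->
  b + a + c = th /\ sg i.+1 * b + sg i * a + sg i.-1 * c = th' * sg i + kap.
Proof.
move=> iD u0 hb ha hc.
have inj : injective (fun x => x *: u i).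
  by move=> x y /eqP; rewrite -subr_eq0 -scalerBl scaler_eq0 (negbTE u0) orbF
    subr_eq0 => /eqP.
split; apply: inj => /=.
  by rewrite !scalerDl -hb -ha -hc thin_sum1.
by rewrite -thin_sum2 // hb ha hc !scalerDl !scalerA.
Qed.

End Thin.
End Layers.

(** * The Bose-Mesner algebra and its primitive idempotents *)

Section Scheme.

Context {C : numClosedFieldType} {X : finType} {D : nat} {Y : symScheme X D}.
Hypothesis D_ge3 : (3 <= D)%N.
Hypothesis Ppol : P_polynomial Y.

Local Notation A i := (assoc_mx C Y i).

Lemma sum_enum_val (G : X -> C) :
  \sum_(y : 'I_#|X|) G (enum_val y) = \sum_(z : X) G z.
Proof. by rewrite -(big_enum_val (A := X)). Qed.

Lemma pnum_neq0 x y z : pnum Y (cls Y x y) (cls Y x z) (cls Y z y) <> 0%N.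
Proof.
move=> p0; have := pnumE (cls_le Y x y) (cls_le Y x z) (cls_le Y z y) (erefl
  (cls Y x y)).
by rewrite p0 => /eqP; rewrite cards_eq0 => /eqP/setP/(_ z); rewrite !inE !eqxx.
Qed.

Lemma pnum_exists i j x y : (i <= D)%N -> (j <= D)%N ->
  pnum Y (cls Y x y) i j <> 0%N -> exists z, cls Y x z = i /\ cls Y z y = j.
Proof.
move=> iD jD; have <- := pnumE (cls_le Y x y) iD jD (erefl _).
move/eqP; rewrite -lt0n card_gt0 => /set0Pn[z];
  rewrite inE => /andP[/eqP iz /eqP jz].
by exists z.
Qed.

(** The valency p^0_ii does not depend on the base point, so one pair in R_i suffices. *)
Lemma sphere_neq0 x i : (i <= D)%N -> exists y, cls Y x y = i.
Proof.
move=> iD; have [x' [y' xy]] := cls_nonempty Y iD.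
have xx z : cls Y z z = 0%N by apply/cls_diag.
have := pnum_neq0 x' x' y'; rewrite xx [cls Y y' x']cls_sym xy => p0.
have [|y [yi _]] := @pnum_exists i i x x iD iD; first by rewrite xx.
by exists y.
Qed.

Lemma assoc_mx0 : A 0 = 1%:M.
Proof.
apply/matrixP=> y z; rewrite !mxE; congr (nat_of_bool _)%:R.
apply/eqP/eqP => [/cls_diag/enum_val_inj //|->]; exact/cls_diag.
Qed.

Lemma assoc_mx_tr i : (A i)^T = A i.
Proof. by apply/matrixP=> y z; rewrite !mxE cls_sym. Qed.

Lemma bose_mesner_tr (B : 'M[C]_#|X|) : bose_mesner Y B -> B^T = B.
Proof.
case=> c ->; rewrite raddf_sum; apply: eq_bigr => i _.
by rewrite /= linearZ /= assoc_mx_tr.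
Qed.

Lemma assoc_mx_mul i : (i <= D)%N ->
  A 1 *m A i = \sum_(h < D.+1) (pnum Y h 1 i)%:R *: A h.
Proof.
move=> iD; apply/matrixP=> y z; rewrite mxE summxE.
set a := enum_val y; set b := enum_val z.
have hD : (cls Y a b < D.+1)%N by rewrite ltnS cls_le.
rewrite [RHS](bigD1 (Ordinal hD)) //= !mxE eqxx mulr1 [X in _ = _ + X]big1
  ?addr0; last first.
  move=> h ne; rewrite !mxE -/a -/b; case: eqP => [e|]; rewrite ?mulr0 //.
  by case/eqP: ne; apply: val_inj => /=.
under eq_bigr do rewrite !mxE.
rewrite (sum_enum_val (fun w => (cls Y a w == 1%N)%:R * (cls Y w b == i)%:R)).
have D1 : (1 <= D)%N by lia.
rewrite -(pnumE (cls_le Y a b) D1 iD (erefl _)) cardsE -sum1_card natr_sum.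
rewrite [RHS]big_mkcond; apply: eq_bigr => w _.
by rewrite -natrM mulnb unfold_in /=; case: (_ && _).
Qed.

(* P-polynomiality makes A_1 generate the Bose-Mesner algebra. *)
Lemma bose_mesner_ind (Q : 'M[C]_#|X| -> Prop) :
    Q 1%:M -> (forall B, Q B -> Q (A 1 *m B)) ->
    (forall a B B', Q B -> Q B' -> Q (a *: B + B')) ->
  forall B, bose_mesner Y B -> Q B.
Proof.
move=> Q1 QA QD.
have Q0 : Q 0 by have := QD (-1) _ _ Q1 Q1; rewrite scaleN1r addNr.
have QZ a B : Q B -> Q (a *: B) by move=> QB; rewrite -[_ *: _]addr0;
  apply: (QD).
have QS (I : Type) (r : seq I) (P : pred I) (G : I -> 'M[C]_#|X|) :
    (forall i, P i -> Q (G i)) -> Q (\sum_(i <- r | P i) G i).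
  move=> QG; elim/big_ind: _ => // B B' QB QB'.
  by rewrite -[B]scale1r; apply: (QD).
suff QAi i : (i <= D)%N -> Q (A i).
  by move=> B [c ->]; apply: (QS) => i _; apply/QZ/QAi; rewrite -ltnS.
elim/ltn_ind: i => -[_ _|i IH iD]; first by rewrite assoc_mx0.
have iD' : (i < D.+1)%N by lia.
have [pz pn] := Ppol i.+1 1 i iD (ltnW (ltnW D_ge3)) iD'.
have c0 : (pnum Y i.+1 1 i)%:R != 0 :> C.
  by rewrite pnatr_eq0; apply/eqP/pn; rewrite add1n eqxx.
(* A_1 A_i has a nonzero coefficient at A_(i+1) and none beyond, so this product can be solved for
   A_(i+1). *)
have := assoc_mx_mul i iD'.
have iS : (i.+1 < D.+1)%N by [].
rewrite (bigD1 (Ordinal iS)) //= => e.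
have -> : A i.+1 = (pnum Y i.+1 1 i)%:R^-1 *: (A 1 *m A i
    - \sum_(h < D.+1 | h != Ordinal iS) (pnum Y h 1 i)%:R *: A h).
  by rewrite e addrK scalerA mulVf ?scale1r.
apply: (QZ); rewrite addrC -scaleN1r; apply: (QD); last by apply/QA/IH.
apply: (QS) => h ne; have [hi|hi] := leqP h i; first by apply/QZ/IH; lia.
have hD : (h <= D)%N by rewrite -ltnS.
have {}ne : (i.+1 < h)%N.
  by rewrite ltn_neqAle hi andbT; apply: contraNneq ne => e'; apply/eqP/val_inj.
have [-> //] := Ppol h 1 i hD (ltnW (ltnW D_ge3)) iD'; first by rewrite scale0r.
by rewrite add1n ne.
Qed.

Variable E : nat -> 'M[C]_#|X|.
Variable theta : nat -> C.
Hypothesis idemE : primitive_idempotents Y E.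
Hypothesis thetaE : forall i, (i <= D)%N -> A 1 *m E i = theta i *: E i.

Lemma idem_tr i : (i <= D)%N -> (E i)^T = E i.
Proof. by move=> iD; apply/bose_mesner_tr/(idem_bose_mesner idemE). Qed.

Lemma thetaE_r i : (i <= D)%N -> E i *m A 1 = theta i *: E i.
Proof.
move=> iD; apply: trmx_inj.
by rewrite trmx_mul assoc_mx_tr linearZ /= idem_tr // thetaE.
Qed.

Lemma idem_decomp m (B : 'M[C]_(#|X|, m)) : \sum_(i < D.+1) E i *m B = B.
Proof. by rewrite -mulmx_suml (idem_sum idemE) mul1mx. Qed.

(** An element of M is a polynomial in A_1, so its eigenvalue on E_i is a function of theta_i alone.
    The second conclusion is what separates the theta_i below. *)
Lemma bose_mesner_eigen (B : 'M[C]_#|X|) : bose_mesner Y B ->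
  exists2 be : nat -> C, forall i, (i <= D)%N -> B *m E i = be i *: E i &
    forall i j, theta i = theta j -> be i = be j.
Proof.
move: B; apply: bose_mesner_ind => [|B [be H1 H2]|a B B' [be H1 H2] [be' H1'
  H2']].
- by exists (fun=> 1) => // i _; rewrite mul1mx scale1r.
- exists (fun i => be i * theta i) => [i iD|i j e];
  last by rewrite (H2 _ _ e) e.
  by rewrite -mulmxA H1 // -scalemxAr thetaE // scalerA.
- exists (fun i => a * be i + be' i) => [i iD|i j e];
  last by rewrite (H2 _ _ e) (H2' _ _ e).
  by rewrite mulmxDl -scalemxAl H1 // H1' // scalerA scalerDl.
Qed.

Lemma bose_mesner_span (B : 'M[C]_#|X|) : bose_mesner Y B ->
  exists be : nat -> C, B = \sum_(i < D.+1) be i *: E i.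
Proof.
case/bose_mesner_eigen => be H _; exists be.
rewrite -[LHS]mulmx1 -(idem_sum idemE) mulmx_sumr.
by apply: eq_bigr => i _; rewrite H // -ltnS.
Qed.

(** Otherwise E_i, as an element of M, would have the same eigenvalue on E_i, where it is 1, and on
    E_j, where it is 0. *)
Lemma theta_inj i j : (i <= D)%N -> (j <= D)%N -> theta i = theta j -> i = j.
Proof.
move=> iD jD e; apply/eqP/negPn/negP => ne.
have [be H1 H2] := bose_mesner_eigen _ (idem_bose_mesner idemE iD).
have := H1 _ jD; rewrite (idem_mul idemE) // (negbTE ne) => /esym/eqP.
rewrite -(H2 _ _ e) scaler_eq0 => /orP[/eqP b0|/eqP];
  last exact: (idem_neq0 idemE).
have := H1 _ iD; rewrite (idem_mul idemE) // eqxx b0 scale0r.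
exact: (idem_neq0 idemE).
Qed.

Lemma idem_mulA i j m (B : 'M[C]_(#|X|, m)) : (i <= D)%N -> (j <= D)%N ->
  E i *m (E j *m B) = (i == j)%:R *: (E j *m B).
Proof.
move=> iD jD; rewrite mulmxA (idem_mul idemE) //.
by case: eqP => [->|]; rewrite ?scale1r ?scale0r ?mul0mx.
Qed.

(** Realness lets a vanishing trace of M M^T force M = 0 later on. The conjugate of E_i belongs to
    the conjugate of theta_i; once theta_i is known to be real, distinctness of the eigenvalues
    identifies the conjugate with E_i. *)
Lemma idem_real i y z : (i <= D)%N -> (E i y z)^* = E i y z.
Proof.
move=> iD; set Eb := map_mx Num.conj_op (E i).
suff e : E i = Eb by rewrite [in RHS]e mxE.
have trb : Eb^T = Eb by rewrite /Eb map_trmx idem_tr.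
have Ab : map_mx Num.conj_op (A 1) = A 1.
  by apply/matrixP=> a b; rewrite !mxE conjC_nat.
have thb : Eb *m A 1 = (theta i)^* *: Eb.
  by rewrite -Ab /Eb -map_mxM /= thetaE_r // map_mxZ.
have cross j : (j <= D)%N -> ((theta i)^* - theta j) *: (Eb *m E j) = 0.
  move=> jD; rewrite scalerBl; apply/eqP; rewrite subr_eq0; apply/eqP.
  by rewrite scalemxAl -thb scalemxAr -thetaE // mulmxA.
(* If theta_i were not real, [Eb *m E i] would vanish, but its diagonal entries are the squared
   norms of the columns of E_i. *)
have real_th : (theta i)^* = theta i.
  apply/eqP; rewrite -subr_eq0; apply/eqP.
  move/eqP: (cross i iD); rewrite scaler_eq0 => /orP[/eqP //|/eqP M0].
  case: (idem_neq0 idemE iD); apply/matrixP=> a b; rewrite !mxE; apply/eqP.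
  have sqE c : Eb b c * E i c b = (E i c b)^* * E i c b by rewrite -{1}trb !mxE.
  have := congr1 (fun M : 'M_#|X| => M b b) M0; rewrite !mxE.
  under eq_bigr do rewrite sqE mulrC.
  move/eqP; rewrite psumr_eq0 => [/allP/(_ a)|c _]; last exact: mul_conjC_ge0.
  by rewrite mem_index_enum mul_conjC_eq0 => /(_ isT).
have EbE : Eb = Eb *m E i.
  rewrite -{1}[Eb]mulmx1 -(idem_sum idemE) mulmx_sumr.
  have iS : (i < D.+1)%N by [].
  rewrite (bigD1 (Ordinal iS)) //= big1 ?addr0 // => j ne.
  have jD : (j <= D)%N by rewrite -ltnS.
  move/eqP: (cross j jD); rewrite scaler_eq0 subr_eq0 real_th.
  case/orP => [/eqP /theta_inj e|/eqP //].
  by case/eqP: ne; apply/val_inj; rewrite /= e.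
have EbK : map_mx Num.conj_op Eb = E i.
  by apply/matrixP=> a b; rewrite !mxE conjCK.
(* Conjugating [EbE] gives E_i = E_i Eb, and transposing it gives Eb = E_i Eb. *)
rewrite [RHS]EbE; apply: trmx_inj; rewrite trmx_mul trb idem_tr //.
by rewrite -[LHS]EbK [in LHS]EbE map_mxM /= EbK.
Qed.

End Scheme.

(** * The dual adjacency matrix and its eigenvalues *)

Section DualScheme.

Context {C : numClosedFieldType} {X : finType} {D : nat} {Y : symScheme X D}.
Hypothesis D_ge3 : (3 <= D)%N.
Hypothesis Ppol : P_polynomial Y.
Variable E : nat -> 'M[C]_#|X|.
Variable theta : nat -> C.
Hypothesis idemE : primitive_idempotents Y E.
Hypothesis thetaE : forall i, (i <= D)%N ->
  assoc_mx C Y 1 *m E i = theta i *: E i.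
Hypothesis Qpol : Q_polynomial D E.
Variable x : X.
Local Notation A1 := (assoc_mx C Y 1).
Local Notation As := (dual_adj x E).
Local Notation x0 := (enum_rank x).
Local Notation k := (fun y : 'I_#|X| => cls Y x (enum_val y)).
Local Notation N := (#|X|%:R : C).
Variable thetas : nat -> C.
Hypothesis thetasE : forall i, (i <= D)%N ->
  As *m dual_idem C Y x i%:Z = thetas i *: dual_idem C Y x i%:Z.

Lemma card_neq0 : N != 0.
Proof. by rewrite pnatr_eq0 -lt0n; apply/card_gt0P; exists x. Qed.

Lemma dual_eigenE y : N * E 1%N x0 y = thetas (k y).
Proof.
have := congr1 (fun M : 'M_#|X| => M y y) (thetasE _ (cls_le Y x (enum_val y))).
by rewrite mul_diag_mx !mxE !eqxx !mulr1.
Qed.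

Lemma dual_adjE : As = layer_scale k thetas.
Proof. by congr diag_mx; apply/rowP => y; rewrite !mxE dual_eigenE. Qed.

Lemma dual_adj_entry m (v : 'M[C]_(_, m)) y j :
  (As *m v) y j = N * E 1%N x0 y * v y j.
Proof. by rewrite mul_diag_mx !mxE. Qed.

(** Every class occurs in the row of x, so that row displays all coefficients of B. *)
Lemma bose_mesner_row0 (B : 'M[C]_#|X|) :
  bose_mesner Y B -> (forall y, B x0 y = 0) -> B = 0.
Proof.
case=> c ->  H; rewrite big1 // => i _.
have iD : (i <= D)%N by rewrite -ltnS.
have [y xy] := sphere_neq0 (Y := Y) x i iD.
have := H (enum_rank y); rewrite summxE (bigD1 i) //= big1 ?addr0 => [|j ne].
  by rewrite !mxE !enum_rankK xy eqxx mulr1 => ->; rewrite scale0r.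
rewrite !mxE !enum_rankK xy; case: eqP => [e|]; rewrite ?mulr0 //.
by case/eqP: ne; apply/val_inj.
Qed.

(** Equal dual eigenvalues mean that E_1 takes equal values at (x,y) and (x,z). The Krein recurrence
    carries this over to every E_l, hence to every A_i, and these separate the classes. *)
Lemma thetas_inj i j : (i <= D)%N -> (j <= D)%N -> thetas i = thetas j -> i = j.
Proof.
move=> iD jD; have [y <-] := sphere_neq0 (Y := Y) x i iD;
  have [z <-] := sphere_neq0 (Y := Y) x j jD.
have kE w : cls Y x w = k (enum_rank w) by rewrite enum_rankK.
rewrite (kE y) (kE z) -!dual_eigenE => /(mulfI card_neq0) e1.
have [qn [krein qpol]] := Qpol.
suff Eq l : (l <= D)%N -> E l x0 (enum_rank y) = E l x0 (enum_rank z).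
  have Ai : bose_mesner Y (assoc_mx C Y (k (enum_rank y))).
    exists (fun j => (j == k (enum_rank y))%:R).
    have kD : (k (enum_rank y) < D.+1)%N by rewrite ltnS cls_le.
    rewrite (bigD1 (Ordinal kD)) //= eqxx scale1r big1 ?addr0 // => h ne.
    case: eqP => [e|]; rewrite ?scale0r //.
    by case/eqP: ne; apply/val_inj.
  have [be Abe] := bose_mesner_span D_ge3 Ppol _ _ idemE thetaE _ Ai.
  have : assoc_mx C Y (k (enum_rank y)) x0 (enum_rank y)
       = assoc_mx C Y (k (enum_rank y)) x0 (enum_rank z).
    rewrite Abe !summxE; apply: eq_bigr => h _; rewrite !mxE Eq //.
    by rewrite -ltnS.
  rewrite !mxE enum_rankK eqxx.
  by case: eqP => [-> //|_ /eqP]; rewrite oner_eq0.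
elim/ltn_ind: l => -[|[|l]] IH lD; [by rewrite (idem_triv idemE) !mxE | exact:
  e1 |].
have l1D : (l.+1 <= D)%N by lia.
have D1 : (1 <= D)%N by lia.
have lS : (l.+2 < D.+1)%N by [].
have [_ qn0] := qpol l.+2 1 l.+1 lD D1 l1D.
have {}qn0 : qn l.+2 1 l.+1 != 0 by apply/eqP/qn0; rewrite add1n eqxx.
(* The Krein expansion of the entrywise product of E_1 and E_(l+1), with its E_(l+2) term split off;
   terms with h > l + 2 vanish, so E_(l+2) is determined by the earlier idempotents. *)
have kr w : E 1 x0 w * E l.+1 x0 w = N^-1 * (qn l.+2 1 l.+1 * E l.+2 x0 w
    + \sum_(h < D.+1 | h != Ordinal lS) qn h 1 l.+1 * E h x0 w).
  have := congr1 (fun M : 'M_#|X| => M x0 w) (krein 1 l.+1 D1 l1D).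
  rewrite !mxE => ->; congr (_ * _); rewrite summxE (bigD1 (Ordinal lS)) //=
    mxE.
  by congr (_ + _); apply: eq_bigr => h _; rewrite mxE.
have := kr (enum_rank y); rewrite e1 IH // kr => /(mulfI (invr_neq0 card_neq0)).
have -> : \sum_(h < D.+1 | h != Ordinal lS) qn h 1 l.+1 * E h x0 (enum_rank z)
   = \sum_(h < D.+1 | h != Ordinal lS) qn h 1 l.+1 * E h x0 (enum_rank y).
  apply: eq_bigr => h ne; have [hl|hl] := ltnP h l.+2.
    by rewrite IH //; lia.
  have hD : (h <= D)%N by rewrite -ltnS.
  have hl' : (l.+2 < h)%N.
    by rewrite ltn_neqAle hl andbT; apply: contraNneq ne => e';
      apply/eqP/val_inj.
  have [-> //] := qpol h 1 l.+1 hD D1 l1D; first by rewrite !mul0r.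
  by rewrite add1n hl'.
by move/addIr/(mulfI qn0).
Qed.

Lemma idem_sym i y z : (i <= D)%N -> E i y z = E i z y.
Proof. by move=> iD; rewrite -{1}(idem_tr _ idemE i iD) mxE. Qed.

Lemma mul_dual_adj_entry (v : 'M[C]_#|X|) y z :
  (v *m As) y z = v y z * (N * E 1%N x0 z).
Proof. by rewrite mul_mx_diag !mxE. Qed.

(* The squared norm of E_j A^* E_t equals |X| q^1_{jt} (E_1)_{xx}. *)
Lemma dual_adj_tridiag j t : (j <= D)%N -> (t <= D)%N -> (t.+1 < j)%N ->
  E j *m (As *m E t) = 0.
Proof.
move=> jD tD tj; set M := E j *m (As *m E t).
have D1 : (1 <= D)%N by lia.
have D0 : (0 <= D)%N by [].
have [qn [krein qpol]] := Qpol.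
have qn0 : qn 1 j t = 0 by have [-> //] := qpol 1 j t D1 jD tD; lia.
have real y z : (M y z)^* = M y z.
  rewrite !mxE rmorph_sum; apply: eq_bigr => w _.
  rewrite dual_adj_entry !rmorphM /= conjC_nat.
  by rewrite !(idem_real D_ge3 Ppol E theta idemE thetaE).
have Mtr : M^T = E t *m (As *m E j).
  rewrite /M !trmx_mul !(idem_tr _ idemE) // /dual_adj tr_diag_mx mulmxA //.
have trM : \tr (M *m M^T) = 0.
  rewrite Mtr /M !mulmxA -[_ *m E t *m E t]mulmxA (idem_mul idemE) // eqxx.
  rewrite mxtrace_mulC !mulmxA (idem_mul idemE) // eqxx /mxtrace.
  (* Both factors A^* are diagonal with entries from the row of E_1 at x, so the trace becomes |X|^2
     times the (x,x) entry of E_1 B E_1, where B is the entrywise product of E_j and E_t; the outer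
     E_1 select the Krein parameter q^1_jt. *)
  have entry a : (E j *m As *m E t *m As) a a
      = N ^+ 2 * \sum_b E 1%N x0 a * (map2_mx *%R (E j) (E t)) a b * E 1%N b x0.
    rewrite -mulmxA mxE mulr_sumr; apply: eq_bigr => b _.
    rewrite !mul_dual_adj_entry [map2_mx _ _ _ _ _]mxE [E t b a]idem_sym //.
    by rewrite [E 1%N b x0]idem_sym //; ring.
  under eq_bigr do rewrite entry.
  rewrite -mulr_sumr.
  have -> : \sum_a \sum_b E 1%N x0 a * (map2_mx *%R (E j) (E t)) a b * E 1%N b
    x0
     = (E 1%N *m map2_mx *%R (E j) (E t) *m E 1%N) x0 x0.
    rewrite exchange_big mxE; apply: eq_bigr => b _; rewrite mxE mulr_suml.
    by apply: eq_bigr.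
  rewrite krein // -scalemxAr -scalemxAl mulmx_sumr mulmx_suml big1 ?scaler0
    ?mxE ?mulr0 //.
  move=> l _; have lD : (l <= D)%N by rewrite -ltnS.
  rewrite -scalemxAr -scalemxAl (idem_mul idemE) //.
  by case: eqP => [<-|]; rewrite ?qn0 ?scale0r ?mul0mx ?scaler0.
apply/matrixP=> y z; rewrite [RHS]mxE; apply/eqP.
move/eqP: trM; rewrite /mxtrace psumr_eq0 => [/allP/(_ y)|a _]; last first.
  by rewrite mxE sumr_ge0 // => b _; rewrite [M^T _ _]mxE -{2}real
    mul_conjC_ge0.
rewrite mem_index_enum => /(_ isT); rewrite mxE psumr_eq0 => [/allP/(_ z)|b _];
  last first.
  by rewrite [M^T _ _]mxE -{2}real mul_conjC_ge0.
by rewrite mem_index_enum [M^T _ _]mxE mulf_eq0 orbb => /(_ isT).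
Qed.

Local Notation one := (const_mx 1 : 'cV[C]_#|X|).
Local Notation ex := (delta_mx x0 0 : 'cV[C]_#|X|).

Lemma mul_ex (B : 'M[C]_#|X|) y j : (B *m ex) y j = B y x0.
Proof.
rewrite mxE (bigD1 x0) //= big1 ?addr0; first by rewrite mxE (ord1 j) !eqxx
  mulr1.
by move=> z /negbTE ne; rewrite mxE ne mulr0.
Qed.

Lemma dual_adj_one : As *m one = N *: (E 1%N *m ex).
Proof.
apply/matrixP=> y j; rewrite dual_adj_entry mxE mulr1 [RHS]mxE mul_ex.
by rewrite idem_sym //; lia.
Qed.

Lemma idem0_one : E 0%N *m one = one.
Proof.
apply/matrixP=> y j; rewrite (idem_triv idemE) !mxE.
under eq_bigr do rewrite !mxE mulr1.
by rewrite sumr_const card_ord -[LHS]mulr_natl mulfV // card_neq0.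
Qed.

(** This vector is |X| q^2_11 times column x of E_2. It is the nonzero vector on which the
    tridiagonal relation is tested to find theta_0. *)
Lemma idem2_dual_adj_one : E 2%N *m (As *m (As *m one)) != 0.
Proof.
have [qn [krein qpol]] := Qpol.
have [D1 D2] : (1 <= D)%N /\ (2 <= D)%N by lia.
have qn0 : qn 2 1 1 != 0.
  by have [_ q0] := qpol 2 1 1 D2 D1 D1; apply/eqP/q0.
have -> : As *m (As *m one) = N *: \sum_(l < D.+1) qn l 1 1 *: (E l *m ex).
  apply/matrixP=> y j; rewrite dual_adj_entry dual_adj_one.
  have e : E 1%N x0 y * E 1%N x0 y = N^-1 * \sum_(l < D.+1) qn l 1 1 * E l y x0.
    have := congr1 (fun M : 'M_#|X| => M x0 y) (krein 1 1 D1 D1).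
    rewrite !mxE => ->; congr (_ * _); rewrite summxE; apply: eq_bigr => l _.
    by rewrite mxE idem_sym // -ltnS.
  transitivity (N * (N * (E 1%N x0 y * E 1%N x0 y))).
    have -> : (N *: (E 1%N *m ex)) y j = N * E 1%N x0 y.
      by rewrite mxE mul_ex [E 1%N y x0]idem_sym.
    by rewrite !mulrA [_ * N]mulrC !mulrA.
  rewrite e mulVKf ?card_neq0 // [RHS]mxE summxE; congr (_ * _).
  by apply: eq_bigr => l _; rewrite mxE mul_ex.
rewrite -scalemxAr mulmx_sumr.
have S2 : (2 < D.+1)%N by lia.
rewrite (bigD1 (Ordinal S2)) //= big1 ?addr0 => [|l ne]; last first.
  have lD : (l <= D)%N by rewrite -ltnS.
  rewrite -scalemxAr (idem_mulA _ idemE) //; case: eqP => [e|];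
    rewrite ?scale0r ?scaler0 //.
  by case/eqP: ne; apply/val_inj.
rewrite -scalemxAr (idem_mulA _ idemE) // eqxx scale1r !scaler_eq0 (negbTE
  card_neq0) (negbTE qn0) /=.
apply/eqP=> E0; apply: (idem_neq0 idemE D2); apply: bose_mesner_row0.
  exact: (idem_bose_mesner idemE).
by move=> y; rewrite idem_sym // -(mul_ex _ _ 0) E0 mxE.
Qed.

(** The vertex z witnesses that p^(k y)_(1, k z) is nonzero; P-polynomiality then bounds the
    difference of the layers by 1, and almost-bipartiteness allows equality only at D. *)
Lemma layer_adj : almost_bipartite Y -> forall y z, A1 y z != 0 ->
  [|| k y == (k z).+1, k z == (k y).+1 | (k y == D) && (k z == D)].
Proof.
case=> ab _ y z; rewrite mxE pnatr_eq0 eqb0 negbK => /eqP yz.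
have p0 := pnum_neq0 (Y := Y) (enum_val y) x (enum_val z).
rewrite yz [cls Y _ x]cls_sym [cls Y _ x]cls_sym in p0.
have D1 : (1 <= D)%N by lia.
have [py pz] : (k y <= D)%N /\ (k z <= D)%N by rewrite !cls_le.
have [p1 _] := Ppol (k y) 1 (k z) py D1 pz.
have := ab (k y).
move: p0 p1 py pz; rewrite /=; move: (cls Y x _) (cls Y x _) => i j p0 p1 iD jD.
case: (eqVneq i j) p0 p1 => [<-|ne] p0 p1 abi; last first.
  by apply: contra_notT p0 => nadj; apply: p1; lia.
by case: (ltnP i D) => [/abi /p0 //|Di]; lia.
Qed.

End DualScheme.

(** By Cayley-Hamilton the product of all N - z, over the roots z of the characteristic polynomial,
    kills a nonzero vector of U. The last nonzero partial product, which stays in U, is an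
    eigenvector. *)
Lemma eigenvector_in_subspace {F : closedFieldType} {n} (N : 'M[F]_n)
    (U : {vspace 'cV[F]_n}) :
  (forall v, v \in U -> N *m v \in U) -> U != 0%VS ->
  exists2 v, v \in U & v != 0 /\ exists c, N *m v = c *: v.
Proof.
move=> NU; rewrite -vpick0; move: (memv_pick U); move: (vpick U) => v0 v0U v00.
case: n N U NU v0 v0U v00 => [|n] N U NU v0 v0U v00.
  by case/eqP: v00; apply/matrixP => -[].
have [l lP] := closed_field_poly_normal (char_poly N).
have prodU l' v : v \in U -> \prod_(z <- l') (N - z%:M) *m v \in U.
  elim: l' v => [|z l' IH] v vU; first by rewrite big_nil mul1mx.
  rewrite big_cons -mulmxE -mulmxA mulmxBl memvB //; first exact/NU/IH.
  by rewrite mul_scalar_mx memvZ // IH.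
have : \prod_(z <- l) (N - z%:M) *m v0 = 0.
  have := Cayley_Hamilton N; rewrite lP (eqP (char_poly_monic N)) scale1r
    rmorph_prod /=.
  under eq_bigr do rewrite rmorphB /= horner_mx_X horner_mx_C.
  by move=> ->; rewrite mul0mx.
elim: l {lP} => [|z l IH]; first by rewrite big_nil mul1mx => /eqP;
  rewrite (negbTE v00).
rewrite big_cons -mulmxE -mulmxA; set w := _ *m v0 => e.
have [w0|w0] := eqVneq w 0; first exact: IH.
exists w; first exact: prodU.
split=> //; exists z; apply/eqP; rewrite -subr_eq0 -mul_scalar_mx -mulmxBl.
exact/eqP.
Qed.

(** * Irreducible modules: thinness, support and diameter *)

Section Modules.

Context {C : numClosedFieldType} {X : finType} {D : nat} {Y : symScheme X D}.
Hypothesis D_ge3 : (3 <= D)%N.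
Hypothesis Ppol : P_polynomial Y.
Hypothesis abip : almost_bipartite Y.
Variable x : X.
Local Notation A1 := (assoc_mx C Y 1).
Local Notation k := (fun y : 'I_#|X| => cls Y x (enum_val y)).
Let D_gt0 : (0 < D)%N. Proof. by lia. Qed.
Let k_le (y : 'I_#|X|) : (cls Y x (enum_val y) <= D)%N :=
  cls_le Y x (enum_val y).
Let adj := layer_adj D_ge3 Ppol x abip : forall y z, A1 y z != 0 -> _.

Lemma dual_idem_nat (i : nat) : dual_idem C Y x i%:Z = layer k i.
Proof. by congr diag_mx; apply/rowP => y; rewrite !mxE eqz_nat. Qed.

Lemma dual_idem_neg : dual_idem C Y x (- 1) = 0.
Proof. by apply/matrixP=> y z; rewrite !mxE /= mul0rn. Qed.

Lemma T_module_gen (U : {vspace 'cV[C]_#|X|}) :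
  (forall v, v \in U -> A1 *m v \in U) ->
  (forall i v, (i <= D)%N -> v \in U -> layer k i *m v \in U) -> T_module Y x U.
Proof.
move=> UA Ul B; elim=> {B} [B|i iD|a B _ IH|B1 B2 _ IH1 _ IH2|B1 B2 _ IH1 _ IH2]
  v vU.
- suff H : forall B', bose_mesner Y B' -> forall v, v \in U -> B' *m v \in U.
    by move=> /H; apply.
  apply: (bose_mesner_ind D_ge3 Ppol) => [w wU|B' IH w wU|a B1 B2 IH1 IH2 w wU].
  + by rewrite mul1mx.
  + by rewrite -mulmxA UA ?IH.
  + by rewrite mulmxDl -scalemxAl memvD ?memvZ ?IH1 ?IH2.
- by rewrite dual_idem_nat Ul.
- by rewrite -scalemxAl memvZ ?IH.
- by rewrite mulmxDl memvD ?IH1 ?IH2.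
- by rewrite -mulmxA IH1 ?IH2.
Qed.

Lemma mx_image_neq0 (B : 'M[C]_#|X|) (U : {vspace 'cV[C]_#|X|}) :
  reflect (exists2 v, v \in U & B *m v != 0) (mx_image B U != 0%VS).
Proof.
apply: (iffP idP) => [|[v vU Bv]].
  rewrite -vpick0 => nz; have /memv_imgP[v vU e] := memv_pick (mx_image B U).
  by exists v => //; move: nz; rewrite e lfunE.
apply: contraNneq Bv => e; have : linfun (mulmx B) v \in mx_image B U by apply:
  memv_img.
by rewrite e memv0 lfunE.
Qed.

Lemma mx_imageP (B : 'M[C]_#|X|) (U : {vspace 'cV[C]_#|X|}) w :
  reflect (exists2 v, v \in U & w = B *m v) (w \in mx_image B U).
Proof.
by apply: (iffP memv_imgP) => -[v vU ->]; exists v; rewrite ?lfunE.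
Qed.

Variable W : {vspace 'cV[C]_#|X|}.
Hypothesis Wirr : irreducible_T_module Y x W.

Lemma module_bose_mesner B w : bose_mesner Y B -> w \in W -> B *m w \in W.
Proof. by move=> BM; case: Wirr => WT _ _; apply: WT; apply: Terw_M. Qed.

Lemma module_A w : w \in W -> A1 *m w \in W.
Proof.
apply: module_bose_mesner; exists (fun i => (i == 1%N)%:R).
have S1 : (1 < D.+1)%N by lia.
rewrite (bigD1 (Ordinal S1)) //= scale1r big1 ?addr0 // => i ne.
by case: eqP => [e|]; rewrite ?scale0r //; case/eqP: ne; apply/val_inj.
Qed.

Lemma module_layer i w : w \in W -> layer k i *m w \in W.
Proof.
move=> wW; have [iD|Di] := leqP i D; last by rewrite (layer_gt k_le) ?mem0v.
case: Wirr => WT _ _; rewrite -dual_idem_nat.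
by apply: WT => //; apply: Terw_dual.
Qed.

Lemma module_layer_scale sg w : w \in W -> layer_scale k sg *m w \in W.
Proof.
move=> wW; rewrite -[w](layer_sum k_le) mulmx_sumr memv_suml // => i _.
by rewrite layer_scale_layer memvZ ?module_layer.
Qed.

Variable v : 'cV[C]_#|X|.
Hypothesis vW : v \in W.
Hypothesis v0 : v != 0.
Local Notation u i := (layer k i *m v).
Hypothesis line : forall i j, (j <= D)%N ->
  layer k j *m (A1 *m u i) \in <[u j]>%VS.

Lemma span_layers_module (S : pred nat) :
  (forall i j, (i <= D)%N -> (j <= D)%N -> S i -> ~~ S j ->
     layer k j *m (A1 *m u i) = 0) ->
  T_module Y x (\sum_(i < D.+1 | S i) <[u i]>)%VS.
Proof.
move=> Scl; set U := (\sum_(i < D.+1 | S i) _)%VS.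
have uU (i : 'I_D.+1) c : S i -> c *: u i \in U.
  by move=> Si; apply/memvZ/(subvP (sumv_sup i Si (subvv _)))/memv_line.
apply: T_module_gen => [w /memv_sumP[ws wsP ->]|i w iD /memv_sumP[ws wsP ->]].
  rewrite mulmx_sumr memv_suml // => i Si; have /vlineP[c ->] := wsP i Si.
  rewrite -scalemxAr memvZ // -[A1 *m _](layer_sum k_le) memv_suml // => j _.
  have jD : (j <= D)%N by rewrite -ltnS.
  have [Sj|nSj] := boolP (S j); last by rewrite Scl ?mem0v // -ltnS.
  by have /vlineP[c' ->] := line i j jD; apply: uU.
rewrite mulmx_sumr memv_suml // => j Sj; have /vlineP[c ->] := wsP j Sj.
by rewrite -scalemxAr layer_layer scalerA uU.
Qed.

(** By irreducibility the span of the layers in S is 0, or it is W and then v has no layer outside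
    S. *)
Lemma module_split (S : pred nat) :
  (forall i j, (i <= D)%N -> (j <= D)%N -> S i -> ~~ S j ->
     layer k j *m (A1 *m u i) = 0) ->
  (forall i, (i <= D)%N -> S i -> u i = 0) \/ (forall i, (i <= D)%N -> ~~ S i ->
    u i = 0).
Proof.
move=> Scl; have mod := span_layers_module S Scl; have [_ _ irr] := Wirr.
case: (irr _ mod) => [|U0|UW].
- apply/subv_sumP => i _; rewrite -memvE module_layer //.
- left=> i iD Si; apply/eqP; rewrite -memv0 -U0.
  have iS : (i < D.+1)%N by [].
  exact/(subvP (sumv_sup (Ordinal iS) Si (subvv _)))/memv_line.
right=> i iD nSi; have := module_layer i v vW.
have : v \in W by []; rewrite -UW => /memv_sumP[ws wsP ->] _.
rewrite mulmx_sumr big1 // => j Sj; have /vlineP[c ->] := wsP j Sj.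
rewrite -scalemxAr layer_layer; case: eqP => [e|]; rewrite ?scale0r ?scaler0 //.
by rewrite e Sj in nSi.
Qed.

Lemma module_layer_line i w :
  (i <= D)%N -> w \in W -> layer k i *m w \in <[u i]>%VS.
Proof.
move=> iD; have mod := span_layers_module (@predT nat) (fun _ _ _ _ _ f =>
  False_ind _ (notF f)).
have [_ _ irr] := Wirr; case: (irr _ mod) => [|U0|<-].
- by apply/subv_sumP => j _; rewrite -memvE module_layer.
- case/eqP: v0; apply: (layer0_eq0 k_le) => j jD; apply/eqP; rewrite -memv0 -U0.
  have jS : (j < D.+1)%N by [].
  exact/(subvP (sumv_sup (Ordinal jS) (erefl true) (subvv _)))/memv_line.
move/memv_sumP=> [ws wsP ->]; rewrite mulmx_sumr memv_suml // => j Sj.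
have /vlineP[c ->] := wsP j Sj; rewrite -scalemxAr layer_layer.
by case: eqP => [->|]; rewrite ?scale0r ?scaler0 ?mem0v // !memvZ ?memv_line.
Qed.

(** If A does not lead from layer i to i + 1, the layers up to i span a submodule; if it does not
    lead back, the layers above i do. *)
Lemma support_cut i :
  layer k i.+1 *m (A1 *m u i) = 0 \/ layer k i *m (A1 *m u i.+1) = 0 ->
  (forall j, (j <= i)%N -> u j = 0) \/ (forall j, (i < j)%N -> u j = 0).
Proof.
have zero j : (forall l, (l <= D)%N -> l = j -> u l = 0) -> u j = 0.
  by move=> H; have [jD|Dj] := leqP j D; [exact: H | rewrite (layer_gt k_le)].
case=> cut.
  have [|Z|Z] := module_split (fun j => (j <= i)%N).
  - move=> a b aD bD ai; rewrite -ltnNge => ib.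
    have [e|ne] := boolP ((a == i) && (b == i.+1)).
      by case/andP: e => /eqP -> /eqP ->.
    by apply: (layer_mul0 _ adj); lia.
  - by left=> j ji; apply: zero => l lD lj; apply: Z => //=; lia.
  - by right=> j ji; apply: zero => l lD lj; apply: Z => //=; lia.
have [|Z|Z] := module_split (fun j => (i < j)%N).
- move=> a b aD bD ai; rewrite -leqNgt => ib.
  have [e|ne] := boolP ((b == i) && (a == i.+1)).
    by case/andP: e => /eqP -> /eqP ->.
  by apply: (layer_mul0 _ adj); lia.
- by right=> j ji; apply: zero => l lD lj; apply: Z => //=; lia.
- by left=> j ji; apply: zero => l lD lj; apply: Z => //=; lia.
Qed.

Lemma support_interval : exists r d, (r + d <= D)%N /\
  forall i, (u i != 0) = (r <= i <= r + d)%N.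
Proof.
have uD i : u i != 0 -> (i <= D)%N.
  by apply: contra_neqT; rewrite -ltnNge => Di; rewrite (layer_gt k_le).
have ex : exists i, u i != 0.
  have [/existsP[i ui]|] := boolP [exists i : 'I_D.+1, u i != 0];
    first by exists i.
  rewrite negb_exists => /forallP Z; case/eqP: v0;
    apply: (layer0_eq0 k_le) => j jD.
  have jS : (j < D.+1)%N by [].
  by have := Z (Ordinal jS); rewrite negbK => /eqP.
case: (ex_minnP ex) => r ur rmin; case: (ex_maxnP ex uD) => m um mmax.
have rm := mmax _ ur; exists r, (m - r)%N; rewrite subnKC //.
split=> [|i]; first exact: uD.
apply/idP/idP => [ui|/andP[ri im]]; first by rewrite rmin ?mmax.
apply/eqP => ui.
(* A gap at i inside the support would itself cut the support between i and i + 1. *)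
have [|Z|Z] := @support_cut i.
- by left; rewrite ui !mulmx0.
- by move: ur; rewrite Z ?eqxx.
- have [e|ne] := eqVneq i m; first by rewrite -e ui eqxx in um.
  by move: um; rewrite Z ?eqxx //; lia.
Qed.

Variables r d : nat.
Hypothesis rdD : (r + d <= D)%N.
Hypothesis supp : forall i, (u i != 0) = (r <= i <= r + d)%N.

Lemma support_out i : ~~ (r <= i <= r + d)%N -> u i = 0.
Proof. by rewrite -supp negbK => /eqP. Qed.

Lemma mx_image_dual_idem (i : nat) :
  (mx_image (dual_idem C Y x i%:Z) W != 0%VS) = (r <= i <= r + d)%N.
Proof.
rewrite -supp dual_idem_nat; apply/mx_image_neq0/idP => [[w wW]|ui];
  last by exists v.
have [iD|Di] := leqP i D; last by rewrite !(layer_gt k_le).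
by have /vlineP[c ->] := module_layer_line i w iD wW;
  rewrite scaler_eq0 negb_or => /andP[].
Qed.

Lemma endpointE : endpoint Y x W = r.
Proof.
rewrite /endpoint; set P := (fun i : nat => _ != _).
have PE i : P i = (r <= i <= r + d)%N by exact: mx_image_dual_idem.
have hasP : has P (iota 0 D.+1).
  by apply/hasP; exists r; rewrite ?mem_iota ?PE; lia.
have lt : (find P (iota 0 D.+1) < D.+1)%N by rewrite -[X in (_ < X)%N](size_iota
  0) -has_find.
have := nth_find 0%N hasP; rewrite nth_iota // add0n PE => /andP[rf _].
apply/eqP; rewrite eqn_leq rf andbT leqNgt; apply/negP => fr.
by have := before_find 0%N fr; rewrite nth_iota ?PE; lia.
Qed.

Lemma diameterE : diameter Y x W = d.
Proof.
rewrite /diameter cardE size_filter.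
have -> : count (fun i : 'I_D.+1 => i \in [set i0 : 'I_D.+1 | mx_image
  (dual_idem C Y x i0%:Z) W != 0%VS])
    (Finite.enum _) = count (fun i => r <= i <= r + d)%N (iota 0 D.+1).
  rewrite -val_enum_ord count_map -enumT; apply: eq_count => i /=.
  by rewrite inE mx_image_dual_idem.
have -> : (D.+1 = r + (d.+1 + (D - (r + d))))%N by lia.
rewrite !iotaD !count_cat add0n.
rewrite (@eq_in_count _ _ pred0) ?count_pred0; last by move=> i;
  rewrite mem_iota /=; lia.
rewrite (@eq_in_count _ _ predT) ?count_predT ?size_iota; last by move=> i;
  rewrite mem_iota /=; lia.
rewrite (@eq_in_count _ _ pred0) ?count_pred0 ?addn0 //.
by move=> i; rewrite mem_iota /=; lia.
Qed.

Lemma layer_up_neq0 i : (r <= i < r + d)%N -> layer k i *m (A1 *m u i.+1) != 0.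
Proof.
move=> ri; apply/eqP => e; have [|Z|Z] := @support_cut i; first by right.
  by have := supp r; rewrite Z ?eqxx; lia.
by have := supp (r + d)%N; rewrite Z ?eqxx; lia.
Qed.

Lemma layer_down_neq0 i :
  (r <= i < r + d)%N -> layer k i.+1 *m (A1 *m u i) != 0.
Proof.
move=> ri; apply/eqP => e; have [|Z|Z] := @support_cut i; first by left.
  by have := supp r; rewrite Z ?eqxx; lia.
by have := supp (r + d)%N; rewrite Z ?eqxx; lia.
Qed.

(** On the layers, A w = th w is a three-term recurrence whose upper coefficient is nonzero inside
    the support, so an eigenvector in W is determined by its layer r. Applied to theta_t, this is
    dual thinness at t. *)
Lemma eigenspace_line th w :
  A1 *m v = th *: v -> w \in W -> A1 *m w = th *: w ->
  w \in <[v]>%VS.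
Proof.
move=> Av wW Aw; have rD : (r <= D)%N by lia.
have /vlineP[c wr] := module_layer_line r w rD wW.
pose w' := w - c *: v.
have w'W : w' \in W by rewrite memvB // memvZ.
have Aw' : A1 *m w' = th *: w'.
  by rewrite mulmxBr -scalemxAr Av Aw scalerBr !scalerA mulrC.
suff : w' = 0 by move/eqP; rewrite subr_eq0 => /eqP ->;
  rewrite memvZ ?memv_line.
suff Z : forall i, layer k i *m w' = 0 by apply: (layer0_eq0 k_le) => i _.
have out i : ~~ (r <= i <= r + d)%N -> layer k i *m w' = 0.
  move=> ri; have [iD|Di] := leqP i D; last by rewrite (layer_gt k_le).
  by have /vlineP[c' ->] := module_layer_line i w' iD w'W;
    rewrite support_out ?scaler0.
elim/ltn_ind=> i IH; have [ri|/out //] := boolP (r <= i <= r + d)%N.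
have [<-|ne] := eqVneq r i.
  by rewrite mulmxBr wr -scalemxAr subrr.
case: i IH ri ne => [|i] IH ri ne; first by lia.
have iD : (i <= D)%N by lia.
have := congr1 (mulmx (layer k i)) Aw'.
rewrite (layer_mul A1 D_gt0 adj) // -scalemxAr [layer k i *m w']IH // scaler0.
rewrite [layer k i.-1 *m w']IH ?mulmx0 ?addr0; last by lia.
have /vlineP[c' ->] := module_layer_line i.+1 w' (ltac:(lia)) w'W.
rewrite -!scalemxAr => /eqP; rewrite scaler_eq0 => /orP[/eqP ->|];
  first by rewrite scale0r.
by rewrite (negbTE (layer_up_neq0 i _)) //; lia.
Qed.

(** Here [g m] applies the factors A - theta_j with t <= j < t + m to the bottom layer. Each factor
    climbs one layer, so [g m] is nonzero for m <= d; but D - t + 1 factors annihilate all of W,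
    whose eigencomponents have index at least t. *)
Lemma diameter_bound (E : nat -> 'M[C]_#|X|) (theta : nat -> C) (t : nat) :
  primitive_idempotents Y E ->
  (forall i, (i <= D)%N -> A1 *m E i = theta i *: E i) ->
  (forall i w, (i < t)%N -> w \in W -> E i *m w = 0) -> (t <= D)%N ->
  (t + d <= D)%N.
Proof.
move=> idemE thetaE Et tD; rewrite leqNgt; apply/negP => Dtd.
pose g := fix g m := if m is m'.+1 then A1 *m g m' - theta (t + m')%N *: g m'
  else u r.
have gS m : g m.+1 = A1 *m g m - theta (t + m)%N *: g m by [].
have gW m : g m \in W.
  elim: m => [|m IH]; first exact: module_layer.
  by rewrite gS memvB ?memvZ ?module_A.
have g_out m i : (r + m < i)%N -> layer k i *m g m = 0.
  elim: m i => [|m IH] i ri.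
    by rewrite layer_layer; case: eqP => [e|]; rewrite ?scale0r //; lia.
  have [iD|Di] := leqP i D; last by rewrite (layer_gt k_le).
  rewrite gS mulmxBr (layer_mul A1 D_gt0 adj) // -scalemxAr.
  by rewrite !IH ?mulmx0 ?scaler0 ?addr0 ?subr0 //; lia.
have g_top m : (m <= d)%N -> layer k (r + m) *m g m != 0.
  elim: m => [|m IH] md.
    by rewrite addn0 layer_layer eqxx scale1r supp; lia.
  have rmD : (r + m.+1 <= D)%N by lia.
  rewrite gS mulmxBr (layer_mul A1 D_gt0 adj) // -scalemxAr.
  rewrite [layer k (r + m.+1).+1 *m _]g_out ?[layer k (r + m.+1) *m g m]g_out
    ?mulmx0 ?scaler0 ?add0r ?subr0; try lia.
  rewrite addnS /=.
  have /vlineP[c e] := module_layer_line (r + m) (g m) (ltac:(lia)) (gW m).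
  have := IH (ltnW md); rewrite e scaler_eq0 negb_or => /andP[c0 _].
  by rewrite -!scalemxAr scaler_eq0 negb_or c0 layer_down_neq0 //; lia.
have Eg m j : (j <= D)%N -> (t <= j < t + m)%N -> E j *m g m = 0.
  move=> jD; elim: m => [|m IH] jt; first by lia.
  rewrite gS mulmxBr mulmxA (thetaE_r _ _ idemE thetaE) // -scalemxAl -scalemxAr
    -scalerBl.
  have [-> |ne] := eqVneq j (t + m)%N; first by rewrite subrr scale0r.
  by rewrite IH ?scaler0 //; lia.
have g0 : g (D - t).+1 = 0.
  rewrite -[LHS](idem_decomp _ idemE) big1 // => j _.
  have [jt|tj] := ltnP j t; first exact: Et.
  by apply: Eg; have := ltn_ord j; lia.
by have := g_top (D - t).+1 (ltac:(lia)); rewrite g0 mulmx0 eqxx.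
Qed.

End Modules.

(** * The parametrized eigenvalues and the coefficients of a thin vector *)

Section QRacahForm.

Context {C : numClosedFieldType} {X : finType} {D : nat} {Y : symScheme X D}.
Hypothesis D_ge3 : (3 <= D)%N.
Hypothesis Ppol : P_polynomial Y.
Hypothesis abip : almost_bipartite Y.
Variable E : nat -> 'M[C]_#|X|.
Variable theta : nat -> C.
Hypothesis idemE : primitive_idempotents Y E.
Hypothesis thetaE : forall i, (i <= D)%N ->
  assoc_mx C Y 1 *m E i = theta i *: E i.
Hypothesis Qpol : Q_polynomial D E.
Variable x : X.
Local Notation A1 := (assoc_mx C Y 1).
Local Notation As := (dual_adj x E).
Local Notation x0 := (enum_rank x).
Local Notation k := (fun y : 'I_#|X| => cls Y x (enum_val y)).
Local Notation N := (#|X|%:R : C).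
Variable thetas : nat -> C.
Hypothesis thetasE : forall i, (i <= D)%N ->
  As *m dual_idem C Y x i%:Z = thetas i *: dual_idem C Y x i%:Z.
Variables q s h hs e : C.
Hypotheses (q0 : q != 0) (h0 : h != 0) (hs0 : hs != 0).
Hypothesis theta_form : forall i, (i <= D)%N ->
  theta i = theta 0%N + h * (1 - q ^+ i) * (1 - s * q ^+ (i + 1)) * q ^- i.
(** theta^*_i multiplied out, as a function of z = q^i, with its constant terms collected in [e]. *)
Let sg z := e + hs * (z^-1 + z / (q * (q ^+ D) ^+ 2)).
Hypothesis thetas_form : forall i, (i <= D)%N -> thetas i = sg (q ^+ i).

Let one : 'cV[C]_#|X| := const_mx 1.

Lemma qX_neq0 i : q ^+ i != 0.
Proof. exact: expf_neq0. Qed.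
Hint Resolve qX_neq0 : core.

Lemma sg_shift i : sg (q ^+ i) = sg (q ^+ (2 * D + 1) / q ^+ i).
Proof.
rewrite /sg exprD mulnC exprM expr1.
by field; rewrite q0 !qX_neq0.
Qed.

(** For i <= D this is theta^*_i != theta^*_0. For larger i, q^i = 1 would give theta^*_0 =
    theta^*_(2D+1-i) by the symmetry [sg_shift]. *)
Lemma q_pow_neq1 i : (0 < i <= 2 * D)%N -> q ^+ i != 1.
Proof.
move=> /andP[i0 iD]; have inj := thetas_inj D_ge3 Ppol _ _ idemE thetaE Qpol _ _
  thetasE.
apply/negP => /eqP qi1; have [iD'|iD'] := leqP i D.
  have := inj 0%N i isT iD'; rewrite !thetas_form // qi1 expr0 => /(_ erefl)
    i_eq0.
  by rewrite -i_eq0 in i0.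
have jD : (2 * D + 1 - i <= D)%N by lia.
suff /inj -/(_ isT jD) : thetas 0%N = thetas (2 * D + 1 - i)%N by lia.
rewrite !thetas_form // sg_shift expr0 invr1 mulr1.
by rewrite -[in LHS](@subnK i (2 * D + 1)) ?exprD ?qi1 ?mulr1 //; lia.
Qed.

(* As sg (q^(D+1)) = sg (q^D), the tridiagonal relation also holds for the
   diagonal block of A at level D; its (E_2, E_0) component then forces
   theta_0 - (q + q^-1) theta_1 + theta_2 = 0. *)
Lemma theta0E : theta 0%N = h * (1 + s * q).
Proof.
have D2 : (2 <= D)%N by lia.
have [D0 D1] : (0 <= D)%N /\ (1 <= D)%N by lia.
have q1 : q - 1 != 0.
  by rewrite subr_eq0 -{1}[q]expr1 q_pow_neq1 //; lia.
pose be := q + q^-1.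
suff e0 : theta 0%N - be * theta 1%N + theta 2%N = 0.
  have : (q - 1) ^+ 2 * (theta 0%N - h * (1 + s * q)) == 0.
    apply/eqP; rewrite -(mulr0 (- q)) -e0 /be (theta_form _ D1) (theta_form _
      D2).
    by field.
  by rewrite mulf_eq0 expf_eq0 (negbTE q1) /= subr_eq0 => /eqP.
(* A^* without the constant [e] and the factor [hs], which removes the linear part of the
   tridiagonal relation. *)
pose S := layer_scale k (fun i => q ^- i + q ^+ i / (q * (q ^+ D) ^+ 2)).
pose tau := - (q - q^-1) ^+ 2 / (q * (q ^+ D) ^+ 2).
have AsS v : As *m v = e *: v + hs *: (S *m v) :> 'cV_#|X|.
  apply/matrixP=> y z; rewrite (dual_adjE E x thetas thetasE) layer_scaleE
    [RHS]mxE.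
  rewrite [X in _ = X + _]mxE [X in _ = _ + X]mxE layer_scaleE thetas_form
    ?cls_le //.
  by rewrite /sg; ring.
have SE v : S *m v = hs^-1 *: (As *m v) - (e / hs) *: v :> 'cV_#|X|.
  by rewrite AsS scalerDr !scalerA mulVf // scale1r [_ / _]mulrC addrAC subrr
    add0r.
pose w := As *m one; pose z := E 2%N *m (As *m w).
have z0 : z != 0 := idem2_dual_adj_one D_ge3 E idemE Qpol x.
have oneE : one = E 0%N *m one by rewrite [RHS](idem0_one _ idemE x).
have Aone : A1 *m one = theta 0%N *: one.
  by rewrite {1}oneE mulmxA thetaE // -scalemxAl -oneE.
have wE : w = E 1%N *m w.
  by rewrite /w (dual_adj_one D_ge3 _ idemE) -scalemxAr (idem_mulA _ idemE) //
    scale1r.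
have Aw : A1 *m w = theta 1%N *: w.
  by rewrite {1}wE mulmxA thetaE // -scalemxAl -wE.
have E2w : E 2%N *m w = 0 by rewrite wE (idem_mulA _ idemE) // scale0r.
have E2one : E 2%N *m one = 0 by rewrite oneE (idem_mulA _ idemE) // scale0r.
have E2A v : E 2%N *m (A1 *m v) = theta 2%N *: (E 2%N *m v) :> 'cV_#|X|.
  by rewrite mulmxA (thetaE_r _ _ idemE thetaE) // -scalemxAl.
have Sone : S *m one = hs^-1 *: w - (e / hs) *: one by exact: SE.
have E2Sone : E 2%N *m (S *m one) = 0.
  by rewrite Sone mulmxBr -!scalemxAr E2w E2one !scaler0 subrr.
have E2Sw : E 2%N *m (S *m w) = hs^-1 *: z.
  by rewrite SE mulmxBr -!scalemxAr E2w scaler0 subr0.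
have E2SSone : E 2%N *m (S *m (S *m one)) = (hs^-1 * hs^-1) *: z.
  by rewrite {1}Sone !mulmxBr -!scalemxAr E2Sone E2Sw scaler0 subr0 scalerA.
have := layer_scale_tridiag (fun y => cls_le Y x (enum_val y)) A1
  (layer_adj D_ge3 Ppol x abip) (fun i => q ^- i + q ^+ i / (q * (q ^+ D) ^+ 2))
  be tau one.
rewrite -/S => rel.
have {rel} : E 2%N *m (S *m (S *m (A1 *m one)) - be *: (S *m (A1 *m (S *m one)))
    + A1 *m (S *m (S *m one))) = E 2%N *m (tau *: (A1 *m one)).
  congr (_ *m _); apply: rel => [i iD|].
    rewrite /be /tau [q ^+ i.+1]exprS; field.
    by rewrite q0 !qX_neq0.
  by rewrite /be /tau; field; rewrite q0 qX_neq0.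
(* On the all-ones vector and under E_2, the three terms are theta_0, be theta_1 and theta_2 times
   the same multiple of [z], and the right side vanishes. *)
rewrite -scalemxAr Aone -!scalemxAr E2one !scaler0 mulmxDr mulmxBr -!scalemxAr.
rewrite E2A E2SSone {1}Sone !mulmxBr -!scalemxAr Aw Aone -!scalemxAr E2Sw
  E2Sone.
rewrite !scaler0 subr0 !scalerA -scalerBl -scalerDl => /eqP.
rewrite scaler_eq0 (negbTE z0) orbF => /eqP eq0.
have hs2 : hs^-1 * hs^-1 != 0 by rewrite mulf_neq0 ?invr_eq0.
by apply: (mulfI hs2); rewrite mulr0 -[RHS]eq0; ring.
Qed.

(** Closed forms at every index: the layer equations mention index D + 1, and [tht t.+1] is also
    written when t = D. *)
Let ths i := sg (q ^+ i).
Let tht i := h * (q ^+ i)^-1 * (1 + s * q * (q ^+ i) ^+ 2).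

Lemma theta_tht i : (i <= D)%N -> theta i = tht i.
Proof.
move=> iD; rewrite theta_form // theta0E /tht exprD expr1.
by field; rewrite qX_neq0.
Qed.

Lemma ths_inj i j : (i <= D)%N -> (j <= D)%N -> ths i = ths j -> i = j.
Proof.
move=> iD jD; rewrite /ths -!thetas_form //.
exact: (thetas_inj D_ge3 Ppol _ _ idemE thetaE Qpol _ _ thetasE).
Qed.

Lemma dual_adj_ths : As = layer_scale k ths.
Proof.
rewrite (dual_adjE _ _ _ thetasE); congr diag_mx; apply/rowP => y.
by rewrite !mxE thetas_form // cls_le.
Qed.

Section ThinVector.

Variables (v : 'cV[C]_#|X|) (t : nat) (kap : C).
Hypothesis Av : A1 *m v = tht t *: v.
Hypothesis ASv : A1 *m (As *m v) = tht t.+1 *: (As *m v) + kap *: v.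

Local Notation u i := (layer k i *m v).
Local Notation bvec i := (layer k i *m (A1 *m u i.+1)).
Local Notation avec i := (layer k i *m (A1 *m u i)).
Local Notation cvec i := (layer k i *m (A1 *m u i.-1)).

Let D_gt0 : (0 < D)%N. Proof. by lia. Qed.
Let k_le (y : 'I_#|X|) : (cls Y x (enum_val y) <= D)%N :=
  cls_le Y x (enum_val y).
Let adj := layer_adj D_ge3 Ppol x abip : forall y z, A1 y z != 0 -> _.
Let ASv' : A1 *m (layer_scale k ths *m v)
    = tht t.+1 *: (layer_scale k ths *m v) + kap *: v.
Proof. by rewrite -dual_adj_ths. Qed.

Lemma avec_lt i : (i < D)%N -> avec i = 0.
Proof. exact: avec0 adj v i. Qed.

Lemma thin_line_v i j : (j <= D)%N -> (layer k j *m (A1 *m u i) \in <[u j]>)%VS.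
Proof. exact: thin_line k_le A1 D_gt0 adj v _ _ kap ths ths_inj Av ASv' i j.
  Qed.

Lemma thin_v i : (i <= D)%N -> u i != 0 -> exists b a c,
  [/\ bvec i = b *: u i, avec i = a *: u i, cvec i = c *: u i, b + a + c = tht t &
     ths i.+1 * b + ths i * a + ths i.-1 * c = tht t.+1 * ths i + kap].
Proof.
move=> iD ui; have [b [a [c [hb ha hc]]]] :=
  thin_exists k_le A1 D_gt0 adj v _ _ kap ths ths_inj Av ASv' i iD.
have [e1 e2] := thin_eqs A1 D_gt0 adj v _ _ kap ths Av ASv' i b a c iD ui hb ha
  hc.
by exists b, a, c.
Qed.

Lemma scale_eq0 (w : 'cV[C]_#|X|) (c : C) : w != 0 -> 0 = c *: w -> c = 0.
Proof. by move=> w0 /esym/eqP; rewrite scaler_eq0 (negbTE w0) orbF => /eqP. Qed.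

Variable r : nat.
Hypothesis ur : u r != 0.
Hypothesis cr : cvec r = 0.

(** At the lower end only the b-term survives, so the second equation fixes [kap] for all the other
    systems. *)
Lemma coef_first : (r < D)%N ->
  bvec r = tht t *: u r /\ ths r.+1 * tht t = tht t.+1 * ths r + kap.
Proof.
move=> rD; have [b [a [c []]]] := thin_v r (ltnW rD) ur.
rewrite avec_lt // cr => -> /(scale_eq0 _ _ ur) -> /(scale_eq0 _ _ ur) ->.
by rewrite !addr0 !mulr0 !addr0 => ->.
Qed.

Lemma coef_only : r = D -> avec r = tht t *: u r.
Proof.
move=> rD; have [b [a [c []]]] := thin_v r (eq_leq rD) ur.
have ur1 : u r.+1 = 0 by rewrite (layer_gt k_le) ?rD.
rewrite cr ur1 !mulmx0 => /(scale_eq0 _ _ ur) -> ->.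
by move=> /(scale_eq0 _ _ ur) ->; rewrite addr0 add0r => ->.
Qed.

Lemma coef_mid d i : (r + d = D)%N -> (0 < i < d)%N -> u (r + i) != 0 ->
  cvec (r + i) = (h * (1 - q ^+ i) * (1 + s * q ^+ (2 + 2 * d + 2 * t - i))
             / (q ^+ (t + i) * (q ^+ (2 * d - 2 * i + 1) - 1))) *: u (r + i) /\
  bvec (r + i) = (h * (q ^+ (2 * d + 1 - i) - 1) * (1 + s * q ^+ (2 * t + i + 1))
             / (q ^+ (t + i) * (q ^+ (2 * d - 2 * i + 1) - 1))) *: u (r + i).
Proof.
move=> rD /andP[i0 id] ui; have [_ kE] := coef_first ltac:(lia).
have iD : (r + i < D)%N by lia.
have [b [a [c [-> ha -> e1 e2]]]] := thin_v (r + i) (ltnW iD) ui.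
move: ha; rewrite avec_lt // => /(scale_eq0 _ _ ui) a0.
rewrite a0 addr0 in e1; rewrite a0 mulr0 addr0 in e2.
have [m dE] : exists m, d = (i + m)%N by exists (d - i)%N; lia.
have [] := @coef_interior C q (q ^+ r) (q ^+ i) (q ^+ m) (q ^+ t) h hs s e
  (tht t) (tht t.+1) kap b c q0 (qX_neq0 _) (qX_neq0 _) (qX_neq0 _) (qX_neq0 _)
    hs0.
- by apply: q_pow_neq1; lia.
- by rewrite -exprM -exprS; apply: q_pow_neq1; lia.
- by [].
- by rewrite /tht exprS.
- by move: kE; rewrite /ths /sg -!exprD -addnA -dE rD -exprS.
- by [].
- move: e2; rewrite /ths /sg -!exprD -addnA -dE rD -!exprS.
  have -> : q ^+ (r + i) / q = q ^+ (r + i).-1.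
    by rewrite -[(r + i)%N]prednK ?exprSr ?mulfK //; lia.
  by rewrite -exprD addSn.
move=> -> ->.
have -> : (2 + 2 * d + 2 * t - i = 2 + i + m * 2 + t * 2)%N by lia.
have -> : (2 * d - 2 * i + 1 = 1 + m * 2)%N by lia.
have -> : (2 * d + 1 - i = 1 + i + m * 2)%N by lia.
have -> : (2 * t + i + 1 = 1 + t * 2 + i)%N by lia.
by rewrite !exprD !exprM !expr1 !mulrA.
Qed.

Lemma coef_last d : (r + d = D)%N -> (0 < d)%N -> u D != 0 ->
  cvec D = (h * (1 - q ^+ d) * (1 + s * q ^+ (2 + d + 2 * t))
          / (q ^+ (t + d) * (q - 1))) *: u D /\
  avec D = (h * (q ^+ (d + 1) - 1) * (1 + s * q ^+ (1 + d + 2 * t))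
          / (q ^+ (t + d) * (q - 1))) *: u D.
Proof.
move=> rD d0 ui; have [_ kE] := coef_first ltac:(lia).
have [b [a [c [hb -> -> e1 e2]]]] := thin_v D (leqnn D) ui.
move: hb; rewrite (bvecD k_le A1 v) => /(scale_eq0 _ _ ui) b0.
rewrite b0 add0r in e1; rewrite b0 mulr0 add0r in e2.
have [] := @coef_end C q (q ^+ r) (q ^+ d) (q ^+ t) h hs s e
  (tht t) (tht t.+1) kap c a q0 (qX_neq0 _) (qX_neq0 _) (qX_neq0 _) hs0.
- by apply: q_pow_neq1; lia.
- by rewrite -[q]expr1 q_pow_neq1 //; lia.
- by [].
- by rewrite /tht exprS.
- by move: kE; rewrite /ths /sg -!exprD rD -exprS.
- by [].
- move: e2; rewrite /ths /sg -!exprD rD.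
  by have -> : q ^+ D / q = q ^+ D.-1 by rewrite -[D]prednK ?exprSr ?mulfK //;
    lia.
move=> -> ->.
have -> : (2 + d + 2 * t = 2 + d + t * 2)%N by lia.
have -> : (1 + d + 2 * t = 1 + t * 2 + d)%N by lia.
by rewrite !exprD !exprM !expr1 !mulrA [q * _]mulrC.
Qed.

(** At an upper end below layer D only the c-term survives, which gives a second equation for [kap]
    besides the one from the lower end. *)
Lemma coef_short d : (0 < d)%N -> (r + d < D)%N -> u (r + d) != 0 ->
  u (r + d).+1 = 0 -> 1 + s * q ^+ (2 * t + d + 1) = 0.
Proof.
move=> d0 rD ui un; have [_ kE] := coef_first ltac:(lia).
have [b [a [c [hb ha _ e1 e2]]]] := thin_v (r + d) (ltnW rD) ui.
move: hb; rewrite un !mulmx0 => /(scale_eq0 _ _ ui) b0.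
move: ha; rewrite avec_lt // => /(scale_eq0 _ _ ui) a0.
rewrite a0 b0 !add0r in e1; rewrite a0 b0 !mulr0 !add0r in e2.
transitivity (1 + s * q * (q ^+ t) ^+ 2 * q ^+ d).
  by rewrite mul2n -addnn !exprD; ring.
apply: (@coef_bipartite C q (q ^+ r) (q ^+ d) (q ^+ D) (q ^+ t) h hs s e
  (tht t) (tht t.+1) kap q0 (qX_neq0 _) (qX_neq0 _) (qX_neq0 _) (qX_neq0 _) hs0
    h0).
- by apply: q_pow_neq1; lia.
(* The two sides are q^(2r+d) and q^(2D+1), whose exponents differ by a number from 1 to 2D. *)
- rewrite -!exprM -exprS -!exprD.
  have -> : ((D * 2).+1 = ((D * 2).+1 - (r * 2 + d)) + (r * 2 + d))%N by lia.
  rewrite [X in _ != X]exprD eq_sym -[X in _ != X]mul1r.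
  apply: contra (@q_pow_neq1 ((D * 2).+1 - (r * 2 + d)) _); last by lia.
  by move/eqP/(mulIf (qX_neq0 _))/eqP.
- by [].
- by rewrite /tht exprS.
- by rewrite -exprS; exact: kE.
- move: e2; rewrite /ths -e1 -exprD.
  by have -> : q ^+ (r + d) / q = q ^+ (r + d).-1
    by rewrite -[(r + d)%N]prednK ?exprSr ?mulfK //; lia.
Qed.

End ThinVector.

Lemma layer_one_neq0 i : (i <= D)%N -> layer k i *m one != 0.
Proof.
move=> iD; have [y xy] := sphere_neq0 (Y := Y) x i iD.
apply/eqP => /(congr1 (fun M : 'cV_#|X| => M (enum_rank y) 0)).
by rewrite layerE !mxE enum_rankK xy eqxx mulr1 => /eqP; rewrite oner_eq0.
Qed.

(** All entries are nonnegative, so nothing cancels and a single edge between the two layers is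
    enough. *)
Lemma layer_mul_one_neq0 i j :
  (i <= D)%N -> (j <= D)%N -> pnum Y i 1 j <> 0%N ->
  layer k i *m (A1 *m (layer k j *m one)) != 0.
Proof.
move=> iD jD p0; have [y xy] := sphere_neq0 (Y := Y) x i iD.
have D1 : (1 <= D)%N by lia.
rewrite -xy [cls Y x y]cls_sym in p0.
have [z [yz zx]] := pnum_exists 1 j y x D1 jD p0.
apply/eqP => /(congr1 (fun M : 'cV_#|X| => M (enum_rank y) 0)).
rewrite layerE [RHS]mxE enum_rankK xy eqxx mul1r mxE => /eqP.
rewrite psumr_eq0 => [/allP/(_ (enum_rank z))|w _]; last first.
  by rewrite layerE !mxE mulr_ge0 ?mulr_ge0 ?ler0n.
rewrite mem_index_enum layerE !mxE !enum_rankK yz [cls Y x z]cls_sym zx !eqxx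
  !mulr1.
by rewrite oner_eq0 => /(_ isT).
Qed.

(* The factors 1 + s q^i occur in the intersection numbers of Y, i.e. in the
   coefficients of the primary module, where t = r = 0 and d = D. *)
Lemma s_pow_neq i : (0 < i <= 2 * D + 1)%N -> 1 + s * q ^+ i != 0.
Proof.
move=> /andP[i0 iD]; have D1 : (1 <= D)%N by lia.
pose w := As *m one.
have oneE : one = E 0%N *m one by rewrite [RHS](idem0_one _ idemE x).
have Aone : A1 *m one = tht 0 *: one.
  by rewrite {1}oneE mulmxA thetaE // -scalemxAl -oneE theta_tht.
(* Here [kap] is 0, because A^* maps the all-ones vector into the image of E_1. *)
have Aw : A1 *m w = tht 1 *: w + 0 *: one.
  rewrite scale0r addr0 -theta_tht // /w (dual_adj_one D_ge3 _ idemE)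
    -!scalemxAr.
  by rewrite mulmxA thetaE // -scalemxAl !scalerA mulrC.
have one0 := layer_one_neq0 0 isT.
have c0 := avec_lt one 0 (ltac:(lia) : (0 < D)%N).
have pP a b : (a <= D)%N -> (b <= D)%N ->
    [|| a == b.+1 | b == a.+1] -> pnum Y a 1 b <> 0%N.
  by move=> aD bD ab; have [_] := Ppol a 1 b aD D1 bD; apply; lia.
have up j : (j < D)%N -> layer k j *m (A1 *m (layer k j.+1 *m one)) != 0.
  by move=> jD; apply: layer_mul_one_neq0; [lia|lia|apply: pP; lia].
have down j : (0 < j <= D)%N -> layer k j *m (A1 *m (layer k j.-1 *m one)) != 0.
  by move=> jD; apply: layer_mul_one_neq0; [lia|lia|apply: pP; lia].
have nz (c : C) (u w' : 'cV[C]_#|X|) : w' = c *: u -> w' != 0 -> c != 0.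
  by move=> ->; apply: contra_neq => ->; rewrite scale0r.
(* Exponent i comes from b_(i-1) for i <= D, from a_D for D + 1, from c_D for D + 2, and from
   c_(2D+2-i) beyond. *)
have [iLt|iGe] := ltnP i D.+1.
  case: i i0 iD iLt => [//|[|i]] _ iD iLt.
    have [+ _] := coef_first one 0 0 Aone Aw 0 one0 c0 (ltac:(lia) : (0 < D)%N).
    move=> /nz /(_ (up 0%N D1)); rewrite /tht expr0 invr1 mulr1 mulf_eq0 negb_or
      => /andP[_].
    by rewrite expr1n mulr1.
  have bnd : (0 < i.+1 < D)%N by lia.
  have [_] := coef_mid one 0 0 Aone Aw 0 one0 c0 D i.+1 (add0n D) bnd
    (layer_one_neq0 (0 + i.+1)%N ltac:(lia)).
  move/nz => /(_ (up i.+1 ltac:(lia))).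
  rewrite !mulf_eq0 !negb_or => /andP[/andP[_ +] _].
  by rewrite muln0 add0n addn1.
have [eD|neD] := eqVneq i D.+1.
  have [_ +] := coef_last one 0 0 Aone Aw 0 one0 c0 D (add0n D) D1
    (layer_one_neq0 _ (leqnn D)).
  move/nz => /(_ (layer_mul_one_neq0 _ _ (leqnn D) (leqnn D) (proj2 abip))).
  rewrite !mulf_eq0 !negb_or => /andP[/andP[_ +] _].
  by rewrite muln0 addn0 add1n eD.
have [eD|neD2] := eqVneq i D.+2.
  have [+ _] := coef_last one 0 0 Aone Aw 0 one0 c0 D (add0n D) D1
    (layer_one_neq0 _ (leqnn D)).
  move/nz => /(_ (down D ltac:(lia))).
  rewrite !mulf_eq0 !negb_or => /andP[/andP[_ +] _].
  by rewrite muln0 addn0 add2n eD.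
have bnd : (0 < 2 * D + 2 - i < D)%N by lia.
have [+ _] := coef_mid one 0 0 Aone Aw 0 one0 c0 D (2 * D + 2 - i)%N (add0n D)
  bnd
    (layer_one_neq0 (0 + (2 * D + 2 - i))%N ltac:(lia)).
move/nz => /(_ (down (2 * D + 2 - i)%N ltac:(lia))).
rewrite !mulf_eq0 !negb_or => /andP[/andP[_ +] _].
by have -> : (2 + 2 * D + 2 * 0 - (2 * D + 2 - i) = i)%N by lia.
Qed.

Lemma tht_form i : tht i = h * q ^- i * (1 + s * q ^+ (2 * i + 1)).
Proof. by rewrite /tht mul2n -addnn !exprD; ring. Qed.

(** * The coefficients of an irreducible module *)

Section Module.

Variable W : {vspace 'cV[C]_#|X|}.
Hypothesis Wirr : irreducible_T_module Y x W.
Let t := dual_endpoint D E W.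

Lemma dual_endpoint_spec : [/\ (t <= D)%N, mx_image (E t) W != 0%VS &
  forall i w, (i < t)%N -> w \in W -> E i *m w = 0].
Proof.
rewrite /t /dual_endpoint; set P := (fun i : nat => _ != _).
have hasP : has P (iota 0 D.+1).
  have [_ W0 _] := Wirr; apply/negPn/negP => noP; apply: W0; apply/eqP.
  rewrite -vpick0 -[vpick W](idem_decomp _ idemE) big1 // => j _; apply/eqP.
  move/hasPn: noP => /(_ (j : nat)); rewrite mem_iota /= => /(_ (ltn_ord j)).
  by apply: contraR => Ej; apply/mx_image_neq0; exists (vpick W);
    rewrite ?memv_pick.
have lt : (find P (iota 0 D.+1) < D.+1)%N by rewrite -[X in (_ < X)%N](size_iota
  0) -has_find.
split=> // [|i w it wW].
  by have := nth_find 0%N hasP; rewrite nth_iota // add0n.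
have := before_find 0%N it; rewrite nth_iota ?add0n; last by lia.
move=> /negbFE/eqP P0; apply/eqP/negPn/negP => Ew.
by case/negP: (introT (mx_image_neq0 (E i) W) (ex_intro2 _ _ w wW Ew));
  apply/eqP.
Qed.

Lemma thin_vector : exists v kap, [/\ v \in mx_image (E t) W, v \in W, v != 0,
  A1 *m v = tht t *: v & A1 *m (As *m v) = tht t.+1 *: (As *m v) + kap *: v].
Proof.
have [tD Et0 Elt] := dual_endpoint_spec.
have EW i w : (i <= D)%N -> w \in W -> E i *m w \in W.
  by move=> iD; apply: (module_bose_mesner x W Wirr);
    apply: (idem_bose_mesner idemE).
have AsW w : w \in W -> As *m w \in W.
  by rewrite dual_adj_ths; apply: module_layer_scale.
have [v vEt [v0 [c Nv]]] : exists2 v, v \in mx_image (E t) W &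
    v != 0 /\ exists c, (E t *m As) *m v = c *: v.
  apply: eigenvector_in_subspace => // w /mx_imageP[w' w'W ->].
  apply/mx_imageP; exists (As *m (E t *m w')); last by rewrite -!mulmxA.
  by rewrite AsW ?EW.
have [w0 w0W vE] := mx_imageP _ _ _ vEt.
have vW : v \in W by rewrite vE EW.
have Etv : E t *m v = v by rewrite vE (idem_mulA _ idemE) // eqxx scale1r.
have Av : A1 *m v = tht t *: v.
  by rewrite -{1}Etv mulmxA thetaE // -scalemxAl Etv theta_tht.
(* The E_(t+1) part of A^* v: lower components vanish by minimality of t, higher ones by
   [dual_adj_tridiag], and the E_t part is c v. For t = D it is 0, whatever [tht t.+1] is. *)
pose w := As *m v - c *: v.
have Ew j : (j <= D)%N -> j != t.+1 -> E j *m w = 0.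
  move=> jD jt; rewrite /w mulmxBr -scalemxAr -{2}Etv (idem_mulA _ idemE) //
    Etv.
  have [jlt|jgt|->] := ltngtP j t.
  - by rewrite Elt ?AsW // scale0r scaler0 subrr.
  - rewrite -[v in As *m v]Etv [As *m _]mulmxA mulmxA.
    rewrite (dual_adj_tridiag D_ge3 Ppol _ _ idemE thetaE Qpol x j t jD tD).
      by rewrite mul0mx scale0r scaler0 subrr.
    by rewrite ltn_neqAle eq_sym jt jgt.
  - by rewrite mulmxA Nv scale1r subrr.
have Aw : A1 *m w = tht t.+1 *: w.
  rewrite -{1}[w](idem_decomp _ idemE) -{2}[w](idem_decomp _ idemE).
  rewrite mulmx_sumr scaler_sumr; apply: eq_bigr => j _.
  have jD : (j <= D)%N by rewrite -ltnS.
  have [jt|/(Ew _ jD) ->] := eqVneq (j : nat) t.+1;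
    last by rewrite mulmx0 scaler0.
  by rewrite mulmxA thetaE // -scalemxAl theta_tht // jt.
have AsE : As *m v = w + c *: v by rewrite /w subrK.
exists v, (c * (tht t - tht t.+1)); split=> //.
rewrite {1}AsE mulmxDr Aw -scalemxAr Av AsE [_ *: (w + _)]scalerDr -addrA;
  congr (_ + _).
by rewrite !scalerA -scalerDl; congr (_ *: _); ring.
Qed.

Lemma raising_layer j (w : 'cV[C]_#|X|) :
  raising C Y x *m (layer k j *m w) = layer k j.+1 *m (A1 *m (layer k j *m w)).
Proof.
have [jD|Dj] := leqP j D; last first.
  by rewrite [layer k j *m w](layer_gt (fun y => cls_le Y x (enum_val y))) //
    !mulmx0.
have jS : (j < D.+1)%N by [].
rewrite mulmx_suml (bigD1 (Ordinal jS)) //= big1 ?addr0 => [|i ne].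
  by rewrite -!mulmxA -PoszD addn1 !dual_idem_nat layer_layer eqxx scale1r.
rewrite -!mulmxA dual_idem_nat layer_layer; case: eqP => [ij|];
  last by rewrite scale0r !mulmx0.
by case/eqP: ne; apply/val_inj.
Qed.

Lemma flat_layer j (w : 'cV[C]_#|X|) :
  flat C Y x *m (layer k j *m w) = layer k j *m (A1 *m (layer k j *m w)).
Proof.
have [jD|Dj] := leqP j D; last first.
  by rewrite [layer k j *m w](layer_gt (fun y => cls_le Y x (enum_val y))) //
    !mulmx0.
have jS : (j < D.+1)%N by [].
rewrite mulmx_suml (bigD1 (Ordinal jS)) //= big1 ?addr0 => [|i ne].
  by rewrite -!mulmxA !dual_idem_nat layer_layer eqxx scale1r.
rewrite -!mulmxA !dual_idem_nat layer_layer; case: eqP => [ij|];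
  last by rewrite scale0r !mulmx0.
by case/eqP: ne; apply/val_inj.
Qed.

Lemma lowering_layer j (w : 'cV[C]_#|X|) :
  lowering C Y x *m (layer k j.+1 *m w)
    = layer k j *m (A1 *m (layer k j.+1 *m w)).
Proof.
have [jD|Dj] := leqP j.+1 D; last first.
  by rewrite [layer k j.+1 *m w](layer_gt (fun y => cls_le Y x (enum_val y))) //
    !mulmx0.
have jS : (j.+1 < D.+1)%N by [].
rewrite mulmx_suml (bigD1 (Ordinal jS)) //= big1 ?addr0 => [|i ne].
  have -> : j.+1%:Z - 1 = j%:Z by rewrite -addn1 PoszD addrK.
  by rewrite -!mulmxA !dual_idem_nat layer_layer eqxx scale1r.
rewrite -!mulmxA dual_idem_nat layer_layer; case: eqP => [ij|];
  last by rewrite scale0r !mulmx0.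
by case/eqP: ne; apply/val_inj.
Qed.

Section ThinModule.

Variable v : 'cV[C]_#|X|.
Hypothesis vEt : v \in mx_image (E t) W.
Hypothesis v0 : v != 0.
Hypothesis EtW : forall w, w \in mx_image (E t) W -> w \in <[v]>%VS.

Local Notation u i := (layer k i *m v).
Local Notation r := (endpoint Y x W).

Lemma is_scalar_unique (P I J : 'M[C]_#|X|) c :
  P *m (I *m v) = c *: (J *m v) -> J *m v != 0 ->
  unique (fun c => forall v, v \in mx_image (E t) W -> v <> 0 ->
    P *m (I *m v) = c *: (J *m v)) c.
Proof.
move=> Pv Qv; split=> [w /EtW/vlineP[a ->] _|c' H].
  by rewrite -!scalemxAr Pv !scalerA mulrC.
have v0' : v <> 0 by apply/eqP.
have := H v vEt v0'; rewrite Pv => /eqP.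
by rewrite -subr_eq0 -scalerBl scaler_eq0 (negbTE Qv) orbF subr_eq0 => /eqP.
Qed.

Lemma is_cW_layer i c : u (r + i) != 0 ->
  layer k (r + i) *m (A1 *m u (r + i).-1) = c *: u (r + i) -> is_cW Y x E W i c.
Proof.
move=> ui ec; apply: is_scalar_unique; rewrite -PoszD dual_idem_nat //.
move: (r + i)%N ui ec => [|j] ui ec.
  (* At index 0, E^*_(-1) is 0 while [0.-1] reads 0; the two sides agree because the flat term of
     layer 0 vanishes. *)
  by rewrite dual_idem_neg mul0mx mulmx0 -ec avec_lt //; lia.
have -> : j.+1%:Z - 1 = j%:Z by rewrite -addn1 PoszD addrK.
by rewrite dual_idem_nat raising_layer.
Qed.

Lemma is_aW_layer i c : u (r + i) != 0 ->
  layer k (r + i) *m (A1 *m u (r + i)) = c *: u (r + i) -> is_aW Y x E W i c.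
Proof.
move=> ui ec; apply: is_scalar_unique; rewrite -PoszD !dual_idem_nat //.
by rewrite flat_layer.
Qed.

Lemma is_bW_layer i c : u (r + i) != 0 ->
  layer k (r + i) *m (A1 *m u (r + i).+1) = c *: u (r + i) -> is_bW Y x E W i c.
Proof.
move=> ui ec; apply: is_scalar_unique; rewrite -?PoszD ?addn1 !dual_idem_nat //.
by rewrite lowering_layer.
Qed.

End ThinModule.
Lemma thin_module_coefs (d := diameter Y x W) :
  (d = 0%N ->
     [/\ is_cW Y x E W 0 0,
         is_aW Y x E W 0 (h * q ^- t * (1 + s * q ^+ (2 * t + 1)))
       & is_bW Y x E W 0 0]) /\
  ((1 <= d)%N ->
     is_cW Y x E W 0 0 /\
     (forall i, (1 <= i <= d - 1)%N ->
        is_cW Y x E W i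
          (h * (1 - q ^+ i) * (1 + s * q ^+ (2 + 2 * d + 2 * t - i))
             / (q ^+ (t + i) * (q ^+ (2 * d - 2 * i + 1) - 1)))) /\
     is_cW Y x E W d
       (h * (1 - q ^+ d) * (1 + s * q ^+ (2 + d + 2 * t))
          / (q ^+ (t + d) * (q - 1))) /\
     (forall i, (i <= d - 1)%N -> is_aW Y x E W i 0) /\
     is_aW Y x E W d
       (h * (q ^+ (d + 1) - 1) * (1 + s * q ^+ (1 + d + 2 * t))
          / (q ^+ (t + d) * (q - 1))) /\
     is_bW Y x E W 0 (h * q ^- t * (s * q ^+ (2 * t + 1) + 1)) /\
     (forall i, (1 <= i <= d - 1)%N ->
        is_bW Y x E W i
          (h * (q ^+ (2 * d + 1 - i) - 1) * (1 + s * q ^+ (2 * t + i + 1))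
             / (q ^+ (t + i) * (q ^+ (2 * d - 2 * i + 1) - 1)))) /\
     is_bW Y x E W d 0).
Proof.
have [tD Et0 Elt] := dual_endpoint_spec.
have [v [kap [vEt vW v0 Av ASv]]] := thin_vector.
have line := thin_line_v v t kap Av ASv.
have [r [d' [rdD supp]]] := support_interval D_ge3 Ppol abip x W Wirr v vW v0
  line.
have rE := endpointE D_ge3 Ppol x W Wirr v vW v0 line r d' rdD supp.
have dE := diameterE D_ge3 Ppol x W Wirr v vW v0 line r d' rdD supp.
have tdD := diameter_bound D_ge3 Ppol abip x W Wirr v vW v0 line r d' rdD supp
  E theta t idemE thetaE Elt tD.
have EtW w : w \in mx_image (E t) W -> w \in <[v]>%VS.
  move=> /mx_imageP[w' w'W wE].
  apply: (eigenspace_line D_ge3 Ppol abip x W Wirr v vW v0 line r d' rdD supp _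
    w Av).
    by rewrite wE; apply: (module_bose_mesner x W Wirr) => //;
      apply: (idem_bose_mesner idemE).
  by rewrite wE mulmxA thetaE // -scalemxAl theta_tht.
rewrite /d dE; move: d' dE rdD supp tdD {d} => d dE rdD supp tdD.
have out i : ~~ (r <= i <= r + d)%N -> layer k i *m v = 0.
  by rewrite -supp negbK => /eqP.
have ur : layer k r *m v != 0 by rewrite supp leqnn leq_addr.
have cr : layer k r *m (A1 *m (layer k r.-1 *m v)) = 0.
  case: (posnP r) => [->|r0]; first by rewrite avec_lt // (leq_trans _ D_ge3).
  by rewrite [layer k r.-1 *m v]out ?mulmx0 // negb_and -ltnNge ltn_predL r0.
have thtE := tht_form t.
(* With i = t, j = d, m = D this puts the exponent 2t + d + 1 in the range of [s_pow_neq]. *)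
have bnd (i j m : nat) :
    (i <= m -> i + j <= m -> 0 < 2 * i + j + 1 <= 2 * m + 1)%N.
  by clear; lia.
have rdE : (r + d = D)%N.
  apply/eqP; rewrite eqn_leq rdD leqNgt; apply/negP => rdlt.
  have ud : layer k (r + d) *m v != 0 by rewrite supp leqnn leq_addr.
  have un : layer k (r + d).+1 *m v = 0 by apply: out; rewrite ltnn andbF.
  have [d0|d_gt0] := posnP d.
    (* For d = 0 below layer D, A would kill v, so theta_t = 0 and 1 + s q^(2t+1) = 0. *)
    rewrite d0 addn0 in un rdlt.
    have [+ _] := coef_first v t kap Av ASv r ur cr rdlt.
    rewrite un !mulmx0 => /(scale_eq0 _ _ ur) /eqP;
      rewrite thtE !mulf_eq0 (negbTE h0).
    rewrite invr_eq0 (negbTE (qX_neq0 _)) (negbTE (s_pow_neq _ _)) //.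
    by have := bnd t d D tD tdD; rewrite d0 addn0.
  have := coef_short v t kap Av ASv r ur cr d d_gt0 rdlt ud un.
  by apply/eqP/s_pow_neq/bnd.
have cW := is_cW_layer v vEt v0 EtW; have aW := is_aW_layer v vEt v0 EtW.
have bW := is_bW_layer v vEt v0 EtW; rewrite rE in cW aW bW.
have cW0 : is_cW Y x E W 0 0 by apply: cW; rewrite addn0 // cr scale0r.
have bWd : is_bW Y x E W d 0.
  apply: bW; first by rewrite supp leqnn leq_addr.
  by rewrite [layer k (r + d).+1 *m v]out ?mulmx0 ?scale0r // ltnn andbF.
split=> [d0|d_gt0].
  split=> //; last by rewrite d0 in bWd.
  rewrite -thtE; apply: aW; rewrite addn0 //.
  by apply: (coef_only v t kap Av ASv r ur cr); rewrite -rdE d0 addn0.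
have uD : layer k D *m v != 0 by rewrite supp rdE leqnn -rdE leq_addr.
have [cd ad] := coef_last v t kap Av ASv r ur cr d rdE d_gt0 uD.
have rD : (r < D)%N by rewrite -rdE -[X in (X < _)%N]addn0 ltn_add2l.
have [br _] := coef_first v t kap Av ASv r ur cr rD.
have ui i : (i <= d)%N -> layer k (r + i) *m v != 0.
  by move=> id; rewrite supp leq_addr leq_add2l.
have lt_d i : (i <= d - 1)%N = (i < d)%N by rewrite subn1 -ltnS prednK.
have mid i : (1 <= i <= d - 1)%N -> _ :=
  fun id => coef_mid v t kap Av ASv r ur cr d i rdE
    (etrans (congr1 (andb (0 < i)%N) (esym (lt_d i))) id)
    (ui i (ltnW (etrans (esym (lt_d i)) (proj2 (andP id))))).
split=> //; split=> [i id|].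
  by apply: cW; [apply/ui/ltnW; rewrite -lt_d;
    case/andP: id | case: (mid i id)].
split; first by apply: cW; rewrite rdE.
split=> [i|].
  rewrite lt_d => id; apply: aW; first exact/ui/ltnW.
  by rewrite scale0r avec_lt // -rdE ltn_add2l.
split; first by apply: aW; rewrite rdE.
split; first by apply: bW; rewrite addn0 // br thtE [1 + _]addrC.
split=> // i id.
by apply: bW; [apply/ui/ltnW; rewrite -lt_d; case/andP: id | case: (mid i id)].
Qed.

End Module.
End QRacahForm.

Theorem theorem15p5 (C : numClosedFieldType) (X : finType) (D : nat)
  (Y : symScheme X D) (E : nat -> 'M[C]_#|X|) (x : X)
  (theta thetas : nat -> C) (q s h hs : C)
  (W : {vspace 'cV[C]_#|X|}) (t d : nat) :
  (3 <= D)%N ->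
  P_polynomial Y -> almost_bipartite Y ->
  primitive_idempotents Y E -> Q_polynomial D E ->
  (forall i, (i <= D)%N -> assoc_mx C Y 1 *m E i = theta i *: E i) ->
  (forall i, (i <= D)%N ->
     dual_adj x E *m dual_idem C Y x i%:Z
       = thetas i *: dual_idem C Y x i%:Z) ->
  ~ iso_distance_scheme Y (@odd_graph D) ->
  ~ iso_distance_scheme Y (@folded_cube (2 * D + 1)) ->
  q <> 0 -> h <> 0 -> hs <> 0 ->
  (forall i, (i <= D)%N ->
     theta i = theta 0%N
       + h * (1 - q ^+ i) * (1 - s * q ^+ (i + 1)) * q ^- i) ->
  (forall i, (i <= D)%N ->
     thetas i = thetas 0%N
       + hs * (1 - q ^+ i) * (1 - q ^ (- (2 * D)%:Z - 1 + i%:Z)) * q ^- i) ->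
  irreducible_T_module Y x W ->
  t = dual_endpoint D E W -> d = diameter Y x W ->
  (d = 0%N ->
     [/\ is_cW Y x E W 0 0,
         is_aW Y x E W 0 (h * q ^- t * (1 + s * q ^+ (2 * t + 1)))
       & is_bW Y x E W 0 0]) /\
  ((1 <= d)%N ->
     is_cW Y x E W 0 0 /\
     (forall i, (1 <= i <= d - 1)%N ->
        is_cW Y x E W i
          (h * (1 - q ^+ i) * (1 + s * q ^+ (2 + 2 * d + 2 * t - i))
             / (q ^+ (t + i) * (q ^+ (2 * d - 2 * i + 1) - 1)))) /\
     is_cW Y x E W d
       (h * (1 - q ^+ d) * (1 + s * q ^+ (2 + d + 2 * t))
          / (q ^+ (t + d) * (q - 1))) /\
     (forall i, (i <= d - 1)%N -> is_aW Y x E W i 0) /\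
     is_aW Y x E W d
       (h * (q ^+ (d + 1) - 1) * (1 + s * q ^+ (1 + d + 2 * t))
          / (q ^+ (t + d) * (q - 1))) /\
     is_bW Y x E W 0 (h * q ^- t * (s * q ^+ (2 * t + 1) + 1)) /\
     (forall i, (1 <= i <= d - 1)%N ->
        is_bW Y x E W i
          (h * (q ^+ (2 * d + 1 - i) - 1) * (1 + s * q ^+ (2 * t + i + 1))
             / (q ^+ (t + i) * (q ^+ (2 * d - 2 * i + 1) - 1)))) /\
     is_bW Y x E W d 0).
Proof.
move=> D_ge3 Ppol abip idemE Qpol thetaE thetasE _ _ /eqP q0 /eqP h0 /eqP hs0.
move=> theta_form thetas_form Wirr -> ->.
(* The constant terms of theta^*_i multiplied out, where q (q^D)^2 = q^(2D+1). *)
pose e := thetas 0%N - hs * (1 + (q * (q ^+ D) ^+ 2)^-1).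
apply: (thin_module_coefs D_ge3 Ppol abip E theta idemE thetaE Qpol x thetas
  thetasE q s h hs e q0 h0 hs0 theta_form) => // i iD.
rewrite thetas_form // expfzDr // -opprD -PoszD addn1 -exprnN exprS mulnC exprM.
rewrite /e -exprnP; field.
by rewrite q0 !expf_neq0.
Qed.
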